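(* Let $F:(M^{2(m+n+r)},g_M,J)\to(N^{n+2r},g_N)$ be a conformal semi-invariant submersion with $n+2r\neq2$, where $(M,g_M,J)$ is a Kähler manifold and $(N,g_N)$ is a Riemannian manifold. Then any two of the conditions below imply the third: (i) $F$ is harmonic; (ii) the fibres of $F$ are minimal; (iii) $F$ is a horizontally homothetic map.
   Context: A Kähler manifold $(M,g_M,J)$ is a Riemannian manifold with a $(1,1)$-tensor $J$ such that $J^2=-I$, $g_M(JX,JY)=g_M(X,Y)$ and $\nabla^M J=0$, where $\nabla^M$ is the Levi-Civita connection. A smooth submersion $F:(M,g_M)\to(N,g_N)$ is horizontally conformal with dilation $\lambda$ ($\lambda$ a positive function on $M$) if $\lambda^2g_M(X,Y)=g_N(F_*X,F_*Y)$ for all $X,Y\in\Gamma((\ker F_* )^\perp)$. It is a conformal semi-invariant submersion if in addition there is a distribution $D_1\subseteq\ker F_*$ with $\ker F_*=D_1\oplus D_2$, $J(D_1)=D_1$, $J(D_2)\subseteq(\ker F_* )^\perp$, where $D_2$ is the orthogonal complement of $D_1$ in $\ker F_*$. Superscripts denote real dimensions: $\dim M=2(m+n+r)$, $\dim N=n+2r$, where $\dim D_1=2m$, $\dim D_2=n$, and the orthogonal complement $\mu$ of $JD_2$ in $(\ker F_* )^\perp$ has dimension $2r$. $F$ is horizontally homothetic if the gradient of $\lambda$ is vertical, i.e. $\mathcal{H}(\mathrm{grad}\,\lambda)=0$, where $\mathcal{H}$ is the orthogonal projection onto $(\ker F_* )^\perp$. $F$ is harmonic if its tension field $\tau(F)=\mathrm{trace}(\nabla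 F_* )$ vanishes, where $(\nabla F_* )(X,Y)=\nabla^F_XF_*Y-F_*(\nabla^M_XY)$ and $\nabla^F$ is the pullback connection on $F^{-1}TN$. *)

(* Defs.v *)
(* Smooth manifolds, connections and second fundamental forms, on top of
   MathComp-Analysis.  Vectors are row vectors: a linear map with matrix A sends
   u to u *m A, a bilinear form with matrix g sends (u, v) to u *m g *m v^T, and
   a subspace is the row space of a matrix. *)
From mathcomp Require Import all_boot all_order all_algebra.
From mathcomp Require Import all_classical all_reals.
From mathcomp Require Import topology normedtype derive.

Set Implicit Arguments.
Unset Strict Implicit.
Unset Printing Implicit Defensive.

Import Order.TTheory GRing.Theory Num.Theory.
Import numFieldNormedType.Exports.

Local Open Scope classical_set_scope.
Local Open Scope ring_scope.

(* C^oo in a neighbourhood of x: near x, all iterated directional derivatives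
   of f exist and are Frechet differentiable. *)
Definition smooth_at (R : realType) (V W : normedModType R) (f : V -> W)
    (x : V) : Prop :=
  \forall y \near x, forall s : seq V,
    differentiable (foldr (fun v h z => 'D_v h z) f s) y.

(* The atlas is indexed by the points of the manifold: every point p comes with
   a chart around it, defined on [dom p], with inverse [param p].  Every atlas
   has a subatlas of this form (choose a chart around each point), and all
   notions below are independent of the choice within a smooth structure. *)
Record manifold (R : realType) (d : nat) := Manifold {
  points :> topologicalType;
  dom : points -> set points;
  chart : points -> points -> 'rV[R]_d;
  param : points -> 'rV[R]_d -> points;
  manifold_hausdorff : hausdorff_space points;
  manifold_second_countable : @second_countable points;
  dom_open : forall p, open (dom p);
  dom_mem : forall p, dom p p;
  chart_open : forall p, open (chart p @` dom p);
  chartK : forall p x, dom p x -> param p (chart p x) = x;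
  chart_continuous : forall p x, dom p x -> {for x, continuous (chart p)};
  param_continuous :
    forall p x, dom p x -> {for chart p x, continuous (param p)};
  transition_smooth : forall p q x, dom p x -> dom q x ->
    smooth_at (chart q \o param p) (chart p x)
}.

Section OneManifold.
Variables (R : realType) (d : nat) (M : manifold R d).
Implicit Types (p q c x : M) (u v : 'rV[R]_d) (f : M -> R).

(* The tangent space at p is 'rV[R]_d, a vector being given by its components
   in the chart at p.  A vector field is thus a function M -> 'rV[R]_d whose
   value at x is read in the chart at x. *)

(* Change of components, at the point x, from the chart at c to that at c'. *)
Definition change_chart c c' x : 'M[R]_d :=
  jacobian (chart c' \o param c) (chart c x).

(* The vector field with constant components v in the chart at p (meaningful
   on dom p). *)
Definition extend p v : M -> 'rV[R]_d := fun x => v *m change_chart p x x.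

Definition fun_smooth_at f p : Prop := smooth_at (f \o param p) (chart p p).

Definition dirder f p v : R := 'D_v (f \o param p) (chart p p).

Definition inner (g : M -> 'M[R]_d) p u v : R := (u *m g p *m v^T) 0 0.

(* Orthogonal complement of the row space of A for the bilinear form g. *)
Definition orth k (g : 'M[R]_d) (A : 'M[R]_(k, d)) : 'M[R]_d :=
  kermx (g *m A^T).

Definition grad (g : M -> 'M[R]_d) f p : 'rV[R]_d :=
  (\row_i dirder f p (delta_mx 0 i)) *m invmx (g p).

(* Trace, with respect to the scalar product g, of the restriction of the
   bilinear map B to the subspace with basis the rows of A: the sum of
   G^{ij} B(a_i, a_j), G being the Gram matrix of the basis. *)
Definition bitrace k e (g : 'M[R]_d) (A : 'M[R]_(k, d))
    (B : 'rV[R]_d -> 'rV[R]_d -> 'rV[R]_e) : 'rV[R]_e :=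
  \sum_(i < k) \sum_(j < k)
    invmx (A *m g *m A^T) i j *: B (row i A) (row j A).

End OneManifold.

Section Maps.
Variables (R : realType) (d e : nat) (M : manifold R d) (N : manifold R e).
Implicit Types (F : M -> N) (p : M).

Definition map_smooth F : Prop := forall p,
  {for p, continuous F} /\
  smooth_at (chart (F p) \o F \o param p) (chart p p).

(* The differential F_* at p. *)
Definition tangent_map F p : 'M[R]_(d, e) :=
  jacobian (chart (F p) \o F \o param p) (chart p p).

(* A section V of F^{-1}TN is a function M -> 'rV[R]_e, with V x tangent to N
   at F x.  It is smooth at p if its components in the chart at F p are. *)
Definition section_smooth_at F (V : M -> 'rV[R]_e) p : Prop :=
  smooth_at ((fun x => V x *m change_chart (F x) (F p) (F x)) \o param p)
            (chart p p).

End Maps.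

Definition vfield_smooth_at (R : realType) (d : nat) (M : manifold R d)
    (X : M -> 'rV[R]_d) (p : M) : Prop :=
  section_smooth_at (fun x : M => x) X p.

Section Connections.
Variables (R : realType) (d e : nat) (M : manifold R d) (N : manifold R e).

(* [D p v V] is the derivative at p of the section V of F^{-1}TN in the
   direction v.  It is only meaningful if V is smooth near p; since f below is
   only required to be smooth near p, the Leibniz rule makes D local. *)
Definition is_connection (F : M -> N)
    (D : M -> 'rV[R]_d -> (M -> 'rV[R]_e) -> 'rV[R]_e) : Prop :=
  [/\ forall p (a : R) u v V, section_smooth_at F V p ->
        D p (a *: u + v) V = a *: D p u V + D p v V,
      forall p v V W, section_smooth_at F V p -> section_smooth_at F W p ->
        D p v (fun x => V x + W x) = D p v V + D p v W,
      forall p v (f : M -> R) V,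
        fun_smooth_at f p -> section_smooth_at F V p ->
        D p v (fun x => f x *: V x) = dirder f p v *: V p + f p *: D p v V
    & forall p X V, vfield_smooth_at X p -> section_smooth_at F V p ->
        section_smooth_at F (fun x => D x (X x) V) p].

Definition is_pullback_connection (F : M -> N)
    (nablaN : N -> 'rV[R]_e -> (N -> 'rV[R]_e) -> 'rV[R]_e)
    (D : M -> 'rV[R]_d -> (M -> 'rV[R]_e) -> 'rV[R]_e) : Prop :=
  is_connection F D /\
  forall p v (W : N -> 'rV[R]_e), vfield_smooth_at W (F p) ->
    D p v (W \o F) = nablaN (F p) (v *m tangent_map F p) W.

End Connections.

Section Geometry.
Variables (R : realType) (d : nat) (M : manifold R d).
Implicit Types (g J : M -> 'M[R]_d).
Implicit Types (nabla : M -> 'rV[R]_d -> (M -> 'rV[R]_d) -> 'rV[R]_d).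

Definition riemannian_metric g : Prop :=
  [/\ forall p, (g p)^T = g p,
      forall p v, v != 0 -> 0 < inner g p v v
    & forall p X Y, vfield_smooth_at X p -> vfield_smooth_at Y p ->
        fun_smooth_at (fun x => inner g x (X x) (Y x)) p].

(* Torsion-freeness is nabla_X Y - nabla_Y X = [X, Y], where the Lie bracket
   is the commutator of X and Y as derivations of functions. *)
Definition levi_civita g nabla : Prop :=
  [/\ is_connection (fun x : M => x) nabla,
      forall p v X Y, vfield_smooth_at X p -> vfield_smooth_at Y p ->
        dirder (fun x => inner g x (X x) (Y x)) p v =
        inner g p (nabla p v X) (Y p) + inner g p (X p) (nabla p v Y)
    & forall p X Y (f : M -> R),
        vfield_smooth_at X p -> vfield_smooth_at Y p -> fun_smooth_at f p ->
        dirder f p (nabla p (X p) Y - nabla p (Y p) X) =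
        dirder (fun x => dirder f x (Y x)) p (X p) -
        dirder (fun x => dirder f x (X x)) p (Y p)].

Definition kahler g J nabla : Prop :=
  [/\ forall p X, vfield_smooth_at X p ->
        vfield_smooth_at (fun x => X x *m J x) p,
      forall p, J p *m J p = - 1%:M,
      forall p u v, inner g p (u *m J p) (v *m J p) = inner g p u v
    & forall p v Y, vfield_smooth_at Y p ->
        nabla p v (fun x => Y x *m J x) = nabla p v Y *m J p].

Definition smooth_distribution (k : nat) (D : M -> 'M[R]_d) : Prop :=
  forall p, \rank (D p) = k /\
    exists E : 'I_k -> M -> 'rV[R]_d,
      (forall i, vfield_smooth_at (E i) p) /\
      \forall x \near p, ((\matrix_(i < k) E i x) == D x)%MS.

End Geometry.

Section Submersions.
Variables (R : realType) (d e : nat) (M : manifold R d) (N : manifold R e).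
Variables (gM : M -> 'M[R]_d) (gN : N -> 'M[R]_e).
Implicit Types (F : M -> N) (p : M) (lam : M -> R).

Definition submersion F : Prop :=
  map_smooth F /\ forall p, row_full (tangent_map F p).

Definition vertical F p : 'M[R]_d := kermx (tangent_map F p).

Definition horizontal F p : 'M[R]_d := orth (gM p) (vertical F p).

Definition vproj F p : 'M[R]_d := proj_mx (vertical F p) (horizontal F p).

Definition hproj F p : 'M[R]_d := proj_mx (horizontal F p) (vertical F p).

Definition horizontally_conformal lam F : Prop :=
  (forall p, 0 < lam p) /\
  forall p (u v : 'rV[R]_d),
    (u <= horizontal F p)%MS -> (v <= horizontal F p)%MS ->
    lam p ^+ 2 * inner gM p u v =
    inner gN (F p) (u *m tangent_map F p) (v *m tangent_map F p).

Definition horizontally_homothetic lam F : Prop :=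
  forall p, grad gM lam p *m hproj F p = 0.

Definition conformal_semi_invariant (m n r : nat) (J : M -> 'M[R]_d) lam F :
    Prop :=
  [/\ submersion F, horizontally_conformal lam F
    & exists D1 : M -> 'M[R]_d,
        smooth_distribution (2 * m) D1 /\
        forall p,
          let D2 := (vertical F p :&: orth (gM p) (D1 p))%MS in
          let mu := (horizontal F p :&: orth (gM p) (D2 *m J p))%MS in
          [/\ (D1 p <= vertical F p)%MS,
              (D1 p *m J p == D1 p)%MS,
              (D2 *m J p <= horizontal F p)%MS,
              \rank D2 = n
            & \rank mu = (2 * r)%N]].

Section WithConnections.
Variables (nablaM : M -> 'rV[R]_d -> (M -> 'rV[R]_d) -> 'rV[R]_d).
Variables (nablaF : M -> 'rV[R]_d -> (M -> 'rV[R]_e) -> 'rV[R]_e).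

(* (nabla F_* )(X, Y) for vector fields X and Y. *)
Definition second_fundamental_form F (X Y : M -> 'rV[R]_d) p : 'rV[R]_e :=
  nablaF p (X p) (fun x => Y x *m tangent_map F x) -
  nablaM p (X p) Y *m tangent_map F p.

(* nabla F_* is tensorial, so its trace at p may be computed on the extensions
   of tangent vectors at p with constant components in the chart at p. *)
Definition tension_field F p : 'rV[R]_e :=
  bitrace (gM p) 1%:M
    (fun u v => second_fundamental_form F (extend p u) (extend p v) p).

Definition harmonic F : Prop := forall p, tension_field F p = 0.

(* Second fundamental form at p of the fibre of F through p, on vertical
   vectors u and v: the normal (horizontal) part of nabla_u V, where V is a
   vertical vector field with value v at p. *)
Definition fibre_second_fundamental_form F p (u v : 'rV[R]_d) : 'rV[R]_d :=
  nablaM p u (fun x => extend p v x *m vproj F x) *m hproj F p.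

Definition fibre_mean_curvature F p : 'rV[R]_d :=
  (\rank (vertical F p))%:R^-1 *:
  bitrace (gM p) (row_base (vertical F p)) (fibre_second_fundamental_form F p).

Definition minimal_fibres F : Prop := forall p, fibre_mean_curvature F p = 0.

End WithConnections.
End Submersions.

(* Main.v *)
(* Let B be the second fundamental form of F. Since F_* vanishes on vertical fields,
   B(u, v) = - F_*(II(u, v)) for vertical u, v, where II is the second fundamental form of
   the fibres. For horizontal u, v, w, differentiating the pulled-back metric gives
     <B(u, v), F_* w> + <B(u, w), F_* v> = 2 lam lam_u <v, w>,
   and B is symmetric, so a Koszul argument determines <B(u, v), F_* w>. With e = dim N and
   h the trace of II, summing the two traces yields, for horizontal w,
     <tau(F), F_* w> = (2 - e) lam lam_w - lam^2 <h, w>,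
   from which the three implications are immediate when e <> 2. *)
Require Import Defs.
From HB Require Import structures.
From mathcomp Require Import all_boot all_order all_algebra.
From mathcomp Require Import all_classical all_reals.
From mathcomp Require Import topology normedtype derive.
From mathcomp Require Import landau realfun.
From mathcomp Require Import ring lra.

Set Implicit Arguments.
Unset Strict Implicit.
Unset Printing Implicit Defensive.

Import Order.TTheory GRing.Theory Num.Theory.
Import numFieldNormedType.Exports.

Local Open Scope classical_set_scope.
Local Open Scope ring_scope.

(** * Smooth functions on normed modules *)

(** A vector at x is recorded in the chart chosen at x, and charts are chosen point by point, so a
    matrix such as [tangent_map F x] need not vary continuously with x. Before anything is
    differentiated at p, all data are therefore transported to the fixed charts at p and F p, and
    each pointwise identity is carried along by a change of frames. Two objects must then be shown
    differentiable. The horizontal projection, defined through subspaces, is rewritten as [hmx], a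
    rational expression in the metric and the differential. The dilation is given only as a positive
    function; conformality exhibits e lam^2 as the trace of a differentiable matrix, which
    determines lam once e > 0. This is why e = 0 is settled separately. *)

Lemma near_open (T : topologicalType) (P : set T) (x : T) :
  (\forall y \near x, P y) -> exists U, [/\ open U, U x & U `<=` P].
Proof. by rewrite /prop_near1 nbhsE => -[U [oU Ux] UP]; exists U. Qed.

Section SmoothFunctions.
Variables (R : realType) (V : normedModType R).

Lemma near_eq_differentiable (W : normedModType R) (f g : V -> W) (x : V) :
  (\near x, f x = g x) -> differentiable f x -> differentiable g x.
Proof.
move=> fg df; have [dfc fE] := (diff_locallyP _ _).1 df.
have fgx : f x = g x := nbhs_singleton fg.
have gE : g \o shift x = cst (g x) + 'd f x +o_ 0 id.
  move/eqaddoP: fE => fE; apply/eqaddoP => e e0.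
  have fg0 : \forall y \near 0, f (y + x) = g (y + x).
    by move: fg; rewrite (near_shift 0) /= subr0.
  apply: filterS2 fg0 (fE e e0) => y /=.
  by rewrite !fctE /= => <-; rewrite -fgx.
apply/diff_locallyP; rewrite (diff_unique dfc gE); split => //.
Qed.

(** The recursion peels off the innermost derivative: it passes to ['D_v f], so a Leibniz rule is
    applied once and induction on n takes over. Order 0 already asks for differentiability, so only
    the family over all n matches smoothness. *)
Fixpoint Ck (W : normedModType R) n (U : set V) (f : V -> W) : Prop :=
  (forall y, U y -> differentiable f y) /\
  if n is n'.+1 then forall v, Ck n' U ('D_v f) else True.

Lemma Ck_differentiable (W : normedModType R) n U (f : V -> W) y :
  Ck n U f -> U y -> differentiable f y.
Proof. by case: n => [|n] [df _]; exact: df. Qed.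

Lemma CkP (W : normedModType R) U (f : V -> W) :
  (forall n, Ck n U f) <->
  (forall y, U y -> forall s : seq V,
    differentiable (foldr (fun v h z => 'D_v h z) f s) y).
Proof.
split=> [Cf y Uy s|H n].
  elim/last_ind: s f Cf => [|s v IH] f Cf; first exact: (Ck_differentiable (Cf 0%N)).
  by rewrite foldr_rcons; apply: IH => n; exact: (Cf n.+1).2.
elim: n f H => [|n IH] f H; split=> //; first by move=> y /H /(_ [::]).
  by move=> y /H /(_ [::]).
by move=> v; apply: IH => y Uy s; have := H y Uy (rcons s v); rewrite foldr_rcons.
Qed.

Lemma CkW (W : normedModType R) n U (f : V -> W) : Ck n.+1 U f -> Ck n U f.
Proof.
elim: n f => [|n IH] f [df Df]; split=> // v; exact/IH/Df.
Qed.

Lemma smooth_atP (W : normedModType R) (f : V -> W) x :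
  smooth_at f x <-> exists U, [/\ open U, U x & forall n, Ck n U f].
Proof.
split=> [/near_open[U [oU Ux H]]|]; first by exists U; split => //; exact/CkP.
move=> [U [oU Ux H]]; apply: filterS (open_nbhs_nbhs (conj oU Ux)) => y Uy.
exact: (CkP _ _).1.
Qed.

Lemma Ck_eq (W : normedModType R) n U (f g : V -> W) :
  open U -> (forall y, U y -> f y = g y) -> Ck n U f -> Ck n U g.
Proof.
move=> oU; have near_U y (h k : V -> W) :
    (forall y, U y -> h y = k y) -> U y -> \near y, h y = k y.
  by move=> E Uy; apply: filterS (open_nbhs_nbhs (conj oU Uy)).
elim: n f g => [|n IH] f g E [df Df]; split=> //.
- by move=> y Uy; apply: near_eq_differentiable (near_U _ _ _ E Uy) (df y Uy).
- by move=> y Uy; apply: near_eq_differentiable (near_U _ _ _ E Uy) (df y Uy).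
- by move=> v; apply: IH (Df v) => y Uy; exact: near_eq_derive (near_U _ _ _ E Uy).
Qed.

Lemma Ck_subset (W : normedModType R) n (U U' : set V) (f : V -> W) :
  U' `<=` U -> Ck n U f -> Ck n U' f.
Proof.
move=> sU; elim: n f => [|n IH] f [df Df]; split=> //.
- by move=> y /sU /df.
- by move=> y /sU /df.
- by move=> v; exact/IH/Df.
Qed.

Lemma smooth_at_near_eq (W : normedModType R) (f g : V -> W) x :
  (\near x, f x = g x) -> smooth_at f x -> smooth_at g x.
Proof.
move/near_open => -[U0 [oU0 U0x E]] /smooth_atP[U [oU Ux Cf]].
apply/smooth_atP; exists (U0 `&` U); split=> // [|n]; first exact: openI.
apply: (@Ck_eq _ n _ f); [exact: openI|by move=> y [/E]|].
by apply: Ck_subset (Cf n) => y [].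
Qed.

Lemma smooth_at_near (W : normedModType R) (f : V -> W) x :
  smooth_at f x -> \forall y \near x, smooth_at f y.
Proof. by move=> H; apply: near_join. Qed.

Lemma smooth_at_differentiable (W : normedModType R) (f : V -> W) x :
  smooth_at f x -> differentiable f x.
Proof. by move/nbhs_singleton => /(_ [::]). Qed.

Lemma smooth_at_derive (W : normedModType R) (f : V -> W) x v :
  smooth_at f x -> smooth_at ('D_v f) x.
Proof.
move=> /smooth_atP[U [oU Ux Cf]]; apply/smooth_atP; exists U; split=> // n.
exact: (Cf n.+1).2.
Qed.

Lemma Ck_cst (W : normedModType R) n U (a : W) : Ck n U (cst a : V -> W).
Proof.
elim: n a => [|n IH] a; split=> // [v].
have -> : 'D_v (cst a) = cst 0 :> (V -> W) by apply/funext => z; rewrite derive_cst.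
exact: IH.
Qed.

Lemma smooth_at_cst (W : normedModType R) (a : W) x : smooth_at (fun _ : V => a) x.
Proof.
apply/smooth_atP; exists setT; split=> // [|n]; [exact: openT|exact: Ck_cst].
Qed.

Lemma smooth_at_id x : smooth_at (id : V -> V) x.
Proof.
apply/smooth_atP; exists setT; split=> [||n]; [exact: openT|exact: I|].
have Did w : 'D_w (id : V -> V) = cst w by apply/funext => z; rewrite derive_id.
case: n => [|n]; split; [by move=> y _; exact: ex_diff|exact: I|by move=> y _; exact: ex_diff|].
by move=> w; rewrite Did; exact: Ck_cst.
Qed.

Lemma smooth_at_ind2 (W W1 W2 : normedModType R) (op : (V -> W1) -> (V -> W2) -> V -> W) f g x :
  (forall U n f g, open U -> Ck n U f -> Ck n U g -> Ck n U (op f g)) ->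
  smooth_at f x -> smooth_at g x -> smooth_at (op f g) x.
Proof.
move=> H /smooth_atP[U [oU Ux Cf]] /smooth_atP[U' [oU' Ux' Cg]].
have sI : open (U `&` U') by exact: openI.
apply/smooth_atP; exists (U `&` U'); split=> // n; apply: H => //.
  by apply: Ck_subset (Cf n) => y [].
by apply: Ck_subset (Cg n) => y [].
Qed.

Lemma CkD (W : normedModType R) U n (f g : V -> W) :
  open U -> Ck n U f -> Ck n U g -> Ck n U (fun z => f z + g z).
Proof.
move=> oU; elim: n f g => [|n IH] f g Cf Cg.
  split; last exact: I.
  by move=> y Uy; apply: differentiableD; [exact: Cf.1|exact: Cg.1].
split=> [y Uy|v]; first by apply: differentiableD; [exact: Cf.1|exact: Cg.1].
apply: (Ck_eq oU) (IH _ _ (Cf.2 v) (Cg.2 v)) => y Uy.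
by rewrite deriveD //; apply: diff_derivable; [exact: Cf.1|exact: Cg.1].
Qed.

Lemma smooth_atD (W : normedModType R) (f g : V -> W) x :
  smooth_at f x -> smooth_at g x -> smooth_at (fun z => f z + g z) x.
Proof. by apply: (@smooth_at_ind2 W W W (fun f g z => f z + g z)) => *; exact: CkD. Qed.

Lemma CkM U n (f g : V -> R) :
  open U -> Ck n U f -> Ck n U g -> Ck n U (fun z => f z * g z).
Proof.
move=> oU; elim: n f g => [|n IH] f g Cf Cg.
  by split=> // y Uy; apply: differentiableM; [exact: Cf.1|exact: Cg.1].
split=> [y Uy|v]; first by apply: differentiableM; [exact: Cf.1|exact: Cg.1].
apply: (@Ck_eq _ _ _ (fun z => f z * 'D_v g z + g z * 'D_v f z) _ oU).
  by move=> y Uy; rewrite deriveM //; apply: diff_derivable; [exact: Cf.1|exact: Cg.1].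
by apply: CkD => //; apply: IH; [exact: CkW|exact: Cg.2|exact: CkW|exact: Cf.2].
Qed.

Lemma smooth_atM (f g : V -> R) x :
  smooth_at f x -> smooth_at g x -> smooth_at (fun z => f z * g z) x.
Proof. by apply: (@smooth_at_ind2 R R R (fun f g z => f z * g z)) => *; exact: CkM. Qed.

Lemma smooth_atN (f : V -> R) x : smooth_at f x -> smooth_at (fun z => - f z) x.
Proof.
move=> sf; have := smooth_atM (@smooth_at_cst R (-1) x) sf.
by under [X in smooth_at X]eq_fun do rewrite mulN1r.
Qed.

Lemma smooth_at_sum (I : Type) (r : seq I) (P : pred I) (f : I -> V -> R) x :
  (forall i, P i -> smooth_at (f i) x) ->
  smooth_at (fun z => \sum_(i <- r | P i) f i z) x.
Proof.
move=> H; elim: r => [|i r IH].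
  by under [X in smooth_at X]eq_fun do rewrite big_nil; exact: (@smooth_at_cst R).
under [X in smooth_at X]eq_fun do rewrite big_cons.
by case Pi : (P i) => //; apply: smooth_atD => //; exact: H.
Qed.

Lemma smooth_at_prod (I : Type) (r : seq I) (P : pred I) (f : I -> V -> R) x :
  (forall i, P i -> smooth_at (f i) x) ->
  smooth_at (fun z => \prod_(i <- r | P i) f i z) x.
Proof.
move=> H; elim: r => [|i r IH].
  by under [X in smooth_at X]eq_fun do rewrite big_nil; exact: (@smooth_at_cst R).
under [X in smooth_at X]eq_fun do rewrite big_cons.
by case Pi : (P i) => //; apply: smooth_atM => //; exact: H.
Qed.

Lemma CkV U n (f : V -> R) : open U -> (forall y, U y -> f y != 0) ->
  Ck n U f -> Ck n U (fun z => (f z)^-1).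
Proof.
move=> oU f0; elim: n => [|n IH] Cf.
  by split=> // y Uy; apply: differentiableV; [exact: Cf.1|exact: f0].
split=> [y Uy|v]; first by apply: differentiableV; [exact: Cf.1|exact: f0].
(* The derivative of 1/f is written with two factors 1/f, to which the induction hypothesis applies
   at order n. *)
apply: (@Ck_eq _ _ _ (fun z => (cst (-1) z * 'D_v f z) * ((f z)^-1 * (f z)^-1)) _ oU).
  move=> y Uy; rewrite deriveV ?f0 //; last exact/diff_derivable/Cf.1.
  by rewrite !fctE /= mulN1r -invfM -expr2 mulrC mulrN scaleNr.
have CV := IH (CkW Cf).
by do !apply: CkM => //; [exact: Ck_cst|exact: Cf.2].
Qed.

Lemma differentiable_near_neq0 (f : V -> R) x :
  differentiable f x -> f x != 0 -> \forall z \near x, f z != 0.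
Proof.
by move=> /differentiable_continuous df fx; exact: cvgr_neq0 df fx.
Qed.

Lemma smooth_atV (f : V -> R) x : f x != 0 -> smooth_at f x ->
  smooth_at (fun z => (f z)^-1) x.
Proof.
move=> fx sf.
have /near_open :=
  differentiable_near_neq0 (smooth_at_differentiable sf) fx; move=> -[U0 [oU0 U0x E]].
move: sf => /smooth_atP[U [oU Ux Cf]].
have oI : open (U0 `&` U) by exact: openI.
apply/smooth_atP; exists (U0 `&` U); split=> // n; apply: CkV => //.
  by move=> y [/E].
by apply: Ck_subset (Cf n) => y [].
Qed.

(** * Matrix-valued functions: entrywise smoothness, products, inverses and their derivatives *)

Lemma differentiable_mxP k l (A : V -> 'M[R]_(k, l)) x :
  differentiable A x <-> forall i j, differentiable (fun z => A z i j) x.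
Proof.
split=> [dA i j|dA].
  apply: (@differentiable_comp _ _ _ _ A (fun B : 'M[R]_(k, l) => B i j)) => //.
  exact: differentiable_coord.
have -> : A = \sum_(i < k) \sum_(j < l) (fun z => A z i j *: (delta_mx i j : 'M[R]_(k, l))).
  apply/funext => z; rewrite fct_sumE [LHS]matrix_sum_delta; apply: eq_bigr => i _.
  by rewrite fct_sumE.
apply: differentiable_sum => i; apply: differentiable_sum => j.
exact: differentiableZl.
Qed.

Lemma derive_entry k l (A : V -> 'M[R]_(k, l)) x v i j :
  differentiable A x -> 'D_v A x i j = 'D_v (fun z => A z i j) x.
Proof. by move=> dA; rewrite derive_mx ?mxE //; exact: diff_derivable. Qed.

Lemma Ck_mx k l n U (A : V -> 'M[R]_(k, l)) : open U ->
  Ck n U A <-> forall i j, Ck n U (fun z => A z i j).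
Proof.
move=> oU; elim: n A => [|n IH] A.
  split=> [[dA _] i j|dA]; split=> // y Uy; first exact: (differentiable_mxP _ _).1 (dA y Uy) i j.
  by apply/differentiable_mxP => i j; exact: (dA i j).1.
split=> [[dA DA] i j|H].
  split=> [y Uy|v]; first exact: (differentiable_mxP _ _).1 (dA y Uy) i j.
  by apply: (Ck_eq oU) ((IH _).1 (DA v) i j) => y /dA; exact: derive_entry.
have dA y : U y -> differentiable A y.
  by move=> Uy; apply/differentiable_mxP => i j; exact: (H i j).1.
split=> // v; apply/IH => i j; apply: (Ck_eq oU) ((H i j).2 v) => y /dA.
by move/derive_entry ->.
Qed.

Lemma smooth_at_mx k l (A : V -> 'M[R]_(k, l)) x :
  smooth_at A x <-> forall i j, smooth_at (fun z => A z i j) x.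
Proof.
split=> [/smooth_atP[U [oU Ux H]] i j|H].
  by apply/smooth_atP; exists U; split=> // n; apply: (Ck_mx _ _ oU).1.
pose P y := forall i j, forall s : seq V,
   differentiable (foldr (fun v h z => 'D_v h z) (fun z => A z i j) s) y.
(* Each entry is smooth on its own neighbourhood; as there are finitely many entries, one
   neighbourhood serves all. *)
have : \forall y \near x, P y by do 2 apply: filter_forall => ?; exact: H.
move/near_open => -[U [oU Ux HP]]; apply/smooth_atP; exists U; split=> // n.
by apply/Ck_mx => // i j; apply: (CkP _ _).2 => y /HP.
Qed.

Lemma smooth_at_mulmx k l m (A : V -> 'M[R]_(k, l)) (B : V -> 'M[R]_(l, m)) x :
  smooth_at A x -> smooth_at B x -> smooth_at (fun z => A z *m B z) x.
Proof.
move=> /smooth_at_mx sA /smooth_at_mx sB; apply/smooth_at_mx => i j.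
under [X in smooth_at X]eq_fun do rewrite mxE.
by apply: smooth_at_sum => a _; exact: smooth_atM.
Qed.

Lemma smooth_at_trmx k l (A : V -> 'M[R]_(k, l)) x :
  smooth_at A x -> smooth_at (fun z => (A z)^T) x.
Proof.
move=> /smooth_at_mx sA; apply/smooth_at_mx => i j.
by under [X in smooth_at X]eq_fun do rewrite mxE; exact: sA.
Qed.

Lemma smooth_at_subr k l (A B : V -> 'M[R]_(k, l)) x :
  smooth_at A x -> smooth_at B x -> smooth_at (fun z => A z - B z) x.
Proof.
move=> /smooth_at_mx sA /smooth_at_mx sB; apply/smooth_at_mx => i j.
under [X in smooth_at X]eq_fun do rewrite !mxE.
by apply: smooth_atD => //; exact: smooth_atN.
Qed.

Lemma smooth_at_det k (A : V -> 'M[R]_k) x :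
  smooth_at A x -> smooth_at (fun z => \det (A z)) x.
Proof.
move=> /smooth_at_mx sA; apply: smooth_at_sum => s _.
by apply: smooth_atM; [exact: smooth_at_cst|exact: smooth_at_prod].
Qed.

Lemma smooth_at_invmx k (A : V -> 'M[R]_k) x : A x \in unitmx ->
  smooth_at A x -> smooth_at (fun z => invmx (A z)) x.
Proof.
move=> uA sA; have sD := smooth_at_det sA.
have uD : \det (A x) != 0 by rewrite -unitfE -unitmxE.
have nU : \forall z \near x, A z \in unitmx.
  have : \forall z \near x, \det (A z) != 0.
    exact: differentiable_near_neq0 (smooth_at_differentiable sD) uD.
  by apply: filterS => z; rewrite unitmxE unitfE.
(* [invmx] returns its argument when that is singular, so Cramer's formula agrees with it only where
   the determinant is nonzero, that is, near x. *)
suff : smooth_at (fun z => (\det (A z))^-1 *: \adj (A z)) x.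
  apply: smooth_at_near_eq; apply: filterS nU => z uz.
  by rewrite /invmx uz.
apply/smooth_at_mx => i j; under [X in smooth_at X]eq_fun do rewrite !mxE.
apply: smooth_atM; first exact: smooth_atV.
apply: smooth_atM; first exact: (@smooth_at_cst R).
apply: smooth_at_det; apply/smooth_at_mx => a b.
under [X in smooth_at X]eq_fun do rewrite !mxE.
exact: (smooth_at_mx _ _).1.
Qed.

Lemma derive_mulmx k l m (A : V -> 'M[R]_(k, l)) (B : V -> 'M[R]_(l, m)) x v :
  differentiable A x -> differentiable B x ->
  'D_v (fun z => A z *m B z) x = 'D_v A x *m B x + A x *m 'D_v B x.
Proof.
move=> dA dB; have [/differentiable_mxP eA /differentiable_mxP eB] := (dA, dB).
have E i j : (fun z => (A z *m B z) i j) =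
    \sum_(a < l) ((fun z => A z i a) * (fun z => B z a j)).
  by apply/funext => z; rewrite mxE fct_sumE.
have eM i j a : differentiable ((fun z => A z i a) * (fun z => B z a j)) x.
  exact: differentiableM.
rewrite derive_mx; last first.
  by apply/derivable_mxP => i j; rewrite E; apply: derivable_sum => a; exact: diff_derivable.
rewrite (derive_mx (@diff_derivable _ _ _ A x v dA)) (derive_mx (@diff_derivable _ _ _ B x v dB)).
apply/matrixP => i j; rewrite !mxE E derive_sum; last first.
  by move=> a; exact: diff_derivable.
rewrite -big_split /=; apply: eq_bigr => a _; rewrite !mxE.
rewrite deriveM; [|exact: diff_derivable|exact: diff_derivable].
by rewrite addrC; congr (_ + _); rewrite /GRing.scale /= mulrC.
Qed.

Lemma differentiable_mulmx k l m (A : V -> 'M[R]_(k, l)) (B : V -> 'M[R]_(l, m)) x :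
  differentiable A x -> differentiable B x -> differentiable (fun z => A z *m B z) x.
Proof.
move=> /differentiable_mxP dA /differentiable_mxP dB; apply/differentiable_mxP => i j.
have -> : (fun z => (A z *m B z) i j) = \sum_(a < l) ((fun z => A z i a) * (fun z => B z a j)).
  by apply/funext => z; rewrite mxE fct_sumE.
by apply: differentiable_sum => a; exact: differentiableM.
Qed.

Lemma differentiable_trmx k l (A : V -> 'M[R]_(k, l)) x :
  differentiable A x -> differentiable (fun z => (A z)^T) x.
Proof.
move=> /differentiable_mxP dA; apply/differentiable_mxP => i j.
by have := dA j i; congr (differentiable _ _); apply/funext => z; rewrite mxE.
Qed.

Lemma differentiable_mxtrace k (A : V -> 'M[R]_k) x :
  differentiable A x -> differentiable (fun z => \tr (A z)) x.
Proof.
move=> /differentiable_mxP dA.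
have -> : (fun z => \tr (A z)) = \sum_(i < k) (fun z => A z i i).
  by apply/funext => z; rewrite fct_sumE.
exact: differentiable_sum.
Qed.

Lemma derive_mulmxl k l m (v : 'M[R]_(k, l)) (A : V -> 'M[R]_(l, m)) x u :
  differentiable A x -> 'D_u (fun z => v *m A z) x = v *m 'D_u A x.
Proof.
move=> dA; apply: etrans (derive_mulmx u (differentiable_cst v x) dA) _.
by rewrite derive_cst mul0mx add0r.
Qed.

Lemma derive_mulmxr k l m (A : V -> 'M[R]_(k, l)) (w : 'M[R]_(l, m)) x u :
  differentiable A x -> 'D_u (fun z => A z *m w) x = 'D_u A x *m w.
Proof.
move=> dA; apply: etrans (derive_mulmx u dA (differentiable_cst w x)) _.
by rewrite derive_cst mulmx0 addr0.
Qed.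

Lemma derive_trmx k l (A : V -> 'M[R]_(k, l)) x v :
  differentiable A x -> 'D_v (fun z => (A z)^T) x = ('D_v A x)^T.
Proof.
move=> dA; have /differentiable_mxP eA := dA.
rewrite derive_mx; last first.
  apply/derivable_mxP => i j; under [X in derivable X]eq_fun do rewrite mxE.
  exact: diff_derivable.
rewrite (derive_mx (@diff_derivable _ _ _ A x v dA)); apply/matrixP => i j; rewrite !mxE.
by congr ('D_v _ x); apply/funext => z; rewrite mxE.
Qed.

End SmoothFunctions.

(** * Orthogonal splittings and traces *)

Lemma mx_entry (R : pzRingType) k l (M : 'M[R]_(k, l)) i j :
  M i j = (delta_mx 0 i *m M *m (delta_mx 0 j)^T : 'M_1) 0 0.
Proof. by rewrite -rowE trmx_delta -colE !mxE. Qed.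

Lemma bilinear_mx_inj (R : pzRingType) k l (M M' : 'M[R]_(k, l)) :
  (forall (u : 'rV_k) (v : 'rV_l), (u *m M *m v^T) 0 0 = (u *m M' *m v^T) 0 0) ->
  M = M'.
Proof. by move=> H; apply/matrixP => i j; rewrite mx_entry H -mx_entry. Qed.

(* The orthogonal projection onto the orthogonal complement of the kernel of A. *)
HB.lock Definition hmx (R : realType) d e (G : 'M[R]_d) (A : 'M[R]_(d, e)) : 'M[R]_d :=
  A *m invmx (A^T *m invmx G *m A) *m A^T *m invmx G.

(** As [A^T *m invmx G] is the adjoint of A for G and the standard product on the target, the
    formula is A followed by its Moore-Penrose inverse, when A is surjective. It is rational in G
    and A, hence smooth along with them. *)
Lemma hmxE (R : realType) d e (G : 'M[R]_d) (A : 'M[R]_(d, e)) :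
  hmx G A = A *m invmx (A^T *m invmx G *m A) *m A^T *m invmx G.
Proof. by rewrite hmx.unlock. Qed.

Lemma mul_mx11 (R : pzRingType) (A B : 'M[R]_1) : (A *m B) 0 0 = A 0 0 * B 0 0.
Proof. by rewrite mxE big_ord1. Qed.

Lemma mxtrace_mx11 (R : pzRingType) (A : 'M[R]_1) : \tr A = A 0 0.
Proof. by rewrite /mxtrace big_ord1. Qed.

Section Splitting.
Variables (R : realType) (d e : nat) (G : 'M[R]_d) (A : 'M[R]_(d, e)).
Hypothesis Gsym : G^T = G.
Hypothesis Gpos : forall v : 'rV[R]_d, v != 0 -> 0 < (v *m G *m v^T) 0 0.

Lemma posdef_unitmx : G \in unitmx.
Proof.
rewrite -row_free_unit -kermx_eq0; apply: contraT => /rowV0Pn[v /sub_kermxP vG v0].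
by have := Gpos v0; rewrite vG mul0mx mxE ltxx.
Qed.

Let Gu := posdef_unitmx.

Lemma invmx_sym : (invmx G)^T = invmx G.
Proof. by rewrite trmx_inv Gsym. Qed.

Lemma posdef_invmx (v : 'rV[R]_d) : v != 0 -> 0 < (v *m invmx G *m v^T) 0 0.
Proof.
move=> v0; have w0 : v *m invmx G != 0.
  by apply: contra_neq v0 => E; rewrite -(mulmxKV Gu v) E mul0mx.
by have := Gpos w0; rewrite mulmxKV // trmx_mul invmx_sym mulmxA.
Qed.

Lemma posdef_gram k (E : 'M[R]_(k, d)) : row_free E -> E *m G *m E^T \in unitmx.
Proof.
move=> fE; rewrite -row_free_unit -kermx_eq0.
apply: contraT => /rowV0Pn[v /sub_kermxP vE v0].
have vE0 : v *m E != 0.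
  by apply: contra_neq v0 => H; apply: (row_free_inj fE); rewrite H mul0mx.
have := Gpos vE0.
by rewrite trmx_mul !mulmxA -(mulmxA v) -(mulmxA v) vE mul0mx mxE ltxx.
Qed.

Local Notation hmx := (hmx G A).

Lemma hmx_sym : hmx *m G = G *m hmx^T.
Proof.
rewrite hmxE mulmxKV // !trmx_mul invmx_sym trmx_inv !trmx_mul !trmxK invmx_sym.
by rewrite !mulmxA mulmxV // mul1mx.
Qed.

Lemma ker_hmx k (v : 'M[R]_(k, d)) : v *m A = 0 -> v *m hmx = 0.
Proof. by move=> vA; rewrite hmxE !mulmxA vA !mul0mx. Qed.

Lemma hmx_orth k (v : 'M[R]_(k, d)) : v *m A = 0 -> hmx *m G *m v^T = 0.
Proof.
move=> vA; rewrite hmxE mulmxKV // -(mulmxA _ A^T) -trmx_mul vA trmx0.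
by rewrite mulmx0.
Qed.

Hypothesis Afull : row_full A.

Lemma gramV_unitmx : A^T *m invmx G *m A \in unitmx.
Proof.
rewrite -row_free_unit -kermx_eq0.
apply: contraT => /rowV0Pn[v /sub_kermxP vE v0].
have fA : row_free A^T by rewrite /row_free mxrank_tr.
have vE0 : v *m A^T != 0.
  by apply: contra_neq v0 => H; apply: (row_free_inj fA); rewrite H mul0mx.
have := posdef_invmx vE0.
by rewrite trmx_mul trmxK !mulmxA -(mulmxA v) -(mulmxA v) vE mul0mx mxE ltxx.
Qed.

Let Su := gramV_unitmx.

Lemma hmxA : hmx *m A = A.
Proof. by rewrite hmxE -!mulmxA (mulmxA _ (invmx G)) mulVmx // mulmx1. Qed.

Lemma hmxK : hmx *m hmx = hmx.
Proof. by rewrite {2 3}hmxE !mulmxA hmxA. Qed.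

(** The correction term carries the vertical projection on both sides. On two horizontal vectors its
    first derivative therefore vanishes, and no derivative of the projection has to be evaluated. *)
Lemma hmx_sandwich : hmx *m G = G - (1%:M - hmx) *m G *m (1%:M - hmx)^T.
Proof.
rewrite linearB /= trmx1 mulmxBr mulmx1 mulmxBl mul1mx mulmxBl -[hmx *m G *m _]mulmxA.
by rewrite -hmx_sym mulmxA hmxK subrr subr0 opprB addrCA subrr addr0.
Qed.

(** The trace of a projection is its rank, here found by cyclicity of the trace. It gives the e in
    the constant 2 - e, and it lets the dilation be read off from the pulled-back metric. *)
Lemma mxtrace_hmx : \tr hmx = e%:R.
Proof.
rewrite hmxE -!mulmxA mxtrace_mulC -!mulmxA (mulmxA A^T) mulVmx //.
by rewrite mxtrace1.
Qed.

Lemma kermx_hmx k (v : 'M[R]_(k, d)) : (v <= kermx A)%MS = (v *m hmx == 0).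
Proof.
apply/sub_kermxP/eqP; first exact: ker_hmx.
by move=> H; rewrite -hmxA mulmxA H mul0mx.
Qed.

Lemma orth_hmx k (v : 'M[R]_(k, d)) : (v <= orth G (kermx A))%MS = (v *m hmx == v).
Proof.
apply/sub_kermxP/eqP => [H|E].
  (* The rows of 1 - hmx lie in the kernel of A, so orthogonality gives v G (1 - hmx)^T = 0;
     self-adjointness moves the projection to the left of G, and G is cancelled. *)
  have /submxP[C E] : (1%:M - hmx <= kermx A)%MS.
    by apply/sub_kermxP; rewrite mulmxBl mul1mx hmxA subrr.
  have : v *m G *m (1%:M - hmx)^T = 0.
    by rewrite E trmx_mul mulmxA -(mulmxA v) H mul0mx.
  rewrite linearB /= trmx1 mulmxBr mulmx1 -mulmxA -hmx_sym mulmxA => /eqP.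
  by rewrite subr_eq0 => /eqP /(can_inj (mulmxK Gu)).
by rewrite -E -mulmxA (mulmxA hmx) hmx_orth ?mulmx0 // mulmx_ker.
Qed.

Lemma orth_cap_kermx : (orth G (kermx A) :&: kermx A = 0)%MS.
Proof.
apply/eqP/rowV0P => v; rewrite sub_capmx orth_hmx kermx_hmx => /andP[/eqP -> /eqP //].
Qed.

Lemma proj_horizontal : proj_mx (orth G (kermx A)) (kermx A) = hmx.
Proof.
rewrite -[LHS]mul1mx -(subrK hmx 1%:M) mulmxDl proj_mx_0 ?orth_cap_kermx //.
  by rewrite add0r proj_mx_id ?orth_cap_kermx // orth_hmx hmxK.
by apply/sub_kermxP; rewrite mulmxBl mul1mx hmxA subrr.
Qed.

Lemma proj_vertical : proj_mx (kermx A) (orth G (kermx A)) = 1%:M - hmx.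
Proof.
have c0 : (kermx A :&: orth G (kermx A) = 0)%MS by rewrite capmxC orth_cap_kermx.
rewrite -[LHS]mul1mx -{1}(subrK hmx 1%:M) mulmxDl [X in _ + X]proj_mx_0 //.
  rewrite addr0 proj_mx_id //.
  by apply/sub_kermxP; rewrite mulmxBl mul1mx hmxA subrr.
by rewrite orth_hmx hmxK.
Qed.

(** The left side is the inverse metric of the kernel, seen in the ambient space. Multiplied by G on
    the left it fixes the rows of E and is killed by the horizontal projection, which forces it to
    be the vertical projection; the choice of basis drops out. *)
Lemma row_base_inv_gram (E := row_base (kermx A)) :
  E^T *m invmx (E *m G *m E^T) *m E = invmx G *m (1%:M - hmx).
Proof.
have fE : row_free E by exact: row_base_free.
have EA : E *m A = 0 by apply/sub_kermxP; rewrite eq_row_base.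
apply: (can_inj (mulKmx Gu)); rewrite mulKVmx //; set X := G *m _.
have EX : E *m X = E by rewrite /X !mulmxA mulmxV ?mul1mx //; exact: posdef_gram.
have HX : hmx *m X = 0 by rewrite /X !mulmxA hmx_orth // !mul0mx.
have /submxP[C CE] : (1%:M - hmx <= E)%MS.
  by rewrite eq_row_base; apply/sub_kermxP; rewrite mulmxBl mul1mx hmxA subrr.
by rewrite -[X]mul1mx -{1}(subrK hmx 1%:M) mulmxDl HX addr0 CE -mulmxA EX.
Qed.

(** A factors through the horizontal projection, so projecting arbitrary u and v loses nothing. A
    condition on horizontal vectors thus becomes a matrix identity, which can be differentiated
    along a chart. *)
Lemma conformal_hmx (K : 'M[R]_e) (c : R) :
  (forall u v : 'rV[R]_d, (u <= orth G (kermx A))%MS -> (v <= orth G (kermx A))%MS ->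
     c * (u *m G *m v^T) 0 0 = (u *m A *m K *m (v *m A)^T) 0 0) ->
  A *m K *m A^T = c *: (hmx *m G).
Proof.
move=> H; apply: bilinear_mx_inj => u v.
have E (w : 'rV[R]_d) : (w *m hmx <= orth G (kermx A))%MS.
  by rewrite orth_hmx -mulmxA hmxK.
have := H _ _ (E u) (E v); rewrite -!(mulmxA _ hmx A) hmxA => EH.
rewrite -scalemxAr -scalemxAl [RHS]mxE.
rewrite !trmx_mul !mulmxA in EH *; rewrite -EH; congr (_ * _); congr (_ 0 0).
by rewrite -[u *m hmx *m G *m _]mulmxA -hmx_sym !mulmxA -(mulmxA u) hmxK.
Qed.

(** The vertical term needs only one projection, because [invmx G *m (1%:M - hmx)] is already the
    inverse metric of the kernel. The horizontal term keeps both, so that b is only evaluated on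
    horizontal vectors there. *)
Lemma mxtrace_split (b : 'M[R]_d) :
  \tr (invmx G *m b) = \tr (invmx G *m (1%:M - hmx) *m b)
                       + \tr (invmx G *m (hmx *m b *m hmx^T)).
Proof.
rewrite (mulmxA _ (hmx *m b)) [X in _ + X]mxtrace_mulC !mulmxA.
have -> : hmx^T *m invmx G = invmx G *m hmx.
  by apply: (can_inj (mulKmx Gu)); rewrite mulmxA -hmx_sym mulmxK // mulKVmx.
by rewrite -(mulmxA (invmx G) hmx) hmxK -linearD /= -mulmxDl -mulmxDr subrK mulmx1.
Qed.

(** Pairing with a covector y turns a vector-valued trace over a basis into a matrix trace. It
    serves with E = 1 for the tension field and with E a basis of the kernel for the mean
    curvature. *)
Lemma bitrace_mul k l (E : 'M[R]_(k, d)) (B : 'rV[R]_d -> 'rV[R]_d -> 'rV[R]_l)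
    (b : 'M[R]_d) (y : 'cV[R]_l) :
  (forall i j, B (row i E) (row j E) *m y = row i E *m b *m (row j E)^T) ->
  (bitrace G E B *m y) 0 0 = \tr (E^T *m invmx (E *m G *m E^T) *m E *m b).
Proof.
move=> H; rewrite /bitrace; set I := invmx _.
have Isym : I^T = I by rewrite trmx_inv !trmx_mul trmxK Gsym mulmxA.
have -> : E^T *m I *m E *m b = E^T *m (I *m E *m b) by rewrite !mulmxA.
rewrite mxtrace_mulC -!mulmxA -[in RHS]Isym mulmx_suml summxE /mxtrace.
under [RHS]eq_bigr do rewrite mxE; rewrite exchange_big /=.
apply: eq_bigr => i _; rewrite mulmx_suml summxE; apply: eq_bigr => j _.
rewrite -scalemxAl mxE H [I^T j i]mxE; congr (_ * _).
rewrite -mulmxA !mxE; apply: eq_bigr => a _; rewrite !mxE; congr (_ * _).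
by apply: eq_bigr => a' _; rewrite !mxE.
Qed.

(* The classical trace computation: b is the form <B(u, v), w A>, where B is the second
   fundamental form, l the differential of the dilation c, and w is horizontal. *)
Lemma tension_trace (b : 'M[R]_d) (w : 'rV[R]_d) (l : 'cV[R]_d) (c : R) :
  w *m hmx = w ->
  (forall u v : 'rV[R]_d, u *m hmx = u -> v *m hmx = v ->
    (u *m b *m v^T) 0 0 = c * ((u *m l) 0 0 * (v *m G *m w^T) 0 0
      + (v *m l) 0 0 * (u *m G *m w^T) 0 0 - (w *m l) 0 0 * (u *m G *m v^T) 0 0)) ->
  \tr (invmx G *m b) = \tr (invmx G *m (1%:M - hmx) *m b)
                       + c * (2 - e%:R) * (w *m l) 0 0.
Proof.
move=> wH H; rewrite mxtrace_split; congr (_ + _).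
have wG : hmx *m (G *m w^T) = G *m w^T by rewrite mulmxA hmx_sym -mulmxA -trmx_mul wH.
(* The horizontal part of b consists of two rank-one terms, each of trace w l against the inverse
   metric, minus w l times the horizontal metric, of trace e; hence the factor 2 - e. *)
have -> : hmx *m b *m hmx^T = c *: (hmx *m l *m (w *m G) + G *m w^T *m (l^T *m hmx^T)
     - (w *m l) 0 0 *: (hmx *m G)).
  apply: bilinear_mx_inj => u v.
  have {H} := H (u *m hmx) (v *m hmx); rewrite -!mulmxA !hmxK => /(_ erefl erefl).
  rewrite wG !trmx_mul => H.
  rewrite -scalemxAl -scalemxAr [RHS]mxE {}H; congr (_ * _).
  rewrite mulmxBl mulmxBr mulmxDl mulmxDr [RHS]mxE [X in _ = X + _]mxE.
  rewrite [X in _ = _ + X]mxE -scalemxAl -scalemxAr [X in _ = _ - X]mxE.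
  congr (_ + _ - _).
  - have -> : u *m (hmx *m (l *m (w *m G)) *m v^T)
            = (u *m (hmx *m l)) *m (v *m (G *m w^T))^T.
      by rewrite !trmx_mul trmxK Gsym !mulmxA.
    by rewrite mul_mx11 [X in _ = _ * X]mxE.
  - have -> : u *m (G *m (w^T *m (l^T *m hmx^T)) *m v^T)
            = (u *m (G *m w^T)) *m (v *m (hmx *m l))^T.
      by rewrite !trmx_mul !mulmxA.
    by rewrite mul_mx11 [X in _ = _ * X]mxE mulrC.
  - by rewrite (mulmxA G) -hmx_sym !mulmxA -(mulmxA u hmx hmx) hmxK.
rewrite -scalemxAr mxtraceZ -mulrA; congr (_ * _).
rewrite mulmxBr mulmxDr linearB linearD /= -scalemxAr mxtraceZ.
have -> : \tr (invmx G *m (hmx *m l *m (w *m G))) = (w *m l) 0 0.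
  rewrite mxtrace_mulC -!mulmxA mulmxV // mulmx1 mulmxA mxtrace_mulC mulmxA wH.
  by rewrite mxtrace_mx11.
have -> : \tr (invmx G *m (G *m w^T *m (l^T *m hmx^T))) = (w *m l) 0 0.
  rewrite -!mulmxA mulKmx // mxtrace_mulC -mulmxA -!trmx_mul mxtrace_tr wH.
  by rewrite mxtrace_mx11.
rewrite mxtrace_mulC -mulmxA mulmxV // mulmx1 mxtrace_hmx.
by rewrite [RHS]mulrC mulrBr [_ * 2]mulr_natr mulr2n.
Qed.

End Splitting.

(** * Changes of chart and the chain rule *)

Section Jacobians.
Variable R : realType.

Lemma jacobianE d e (f : 'rV[R]_d -> 'rV[R]_e) x i j :
  differentiable f x -> jacobian f x i j = 'D_(delta_mx 0 i) f x 0 j.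
Proof. by move=> df; rewrite /jacobian mxE deriveE. Qed.

Lemma mul_jacobian d e (f : 'rV[R]_d -> 'rV[R]_e) x v :
  v *m jacobian f x = 'd f x v.
Proof. exact: mul_rV_lin1. Qed.

Lemma row_vector_mx_inj d e (A B : 'M[R]_(d, e)) :
  (forall v : 'rV[R]_d, v *m A = v *m B) -> A = B.
Proof. by move=> H; apply/row_matrixP => i; rewrite !rowE. Qed.

Lemma jacobian_near_eq d e (f g : 'rV[R]_d -> 'rV[R]_e) x :
  (\near x, f x = g x) -> differentiable f x -> jacobian f x = jacobian g x.
Proof.
move=> fg df; have dg := near_eq_differentiable fg df.
apply: row_vector_mx_inj => v.
exact: etrans (esym (deriveEjacobian v df))
  (etrans (near_eq_derive v fg) (deriveEjacobian v dg)).
Qed.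

Lemma jacobian_comp d e k (f : 'rV[R]_d -> 'rV[R]_e) (g : 'rV[R]_e -> 'rV[R]_k) x :
  differentiable f x -> differentiable g (f x) ->
  jacobian (g \o f) x = jacobian f x *m jacobian g (f x).
Proof.
move=> df dg; apply: row_vector_mx_inj => v; apply: etrans (mul_jacobian _ _ _) _.
apply: etrans (congr1 (fun h : _ -> _ => h v) (diff_comp df dg)) _.
apply: etrans (esym (mul_jacobian _ _ _)) _.
apply: etrans (congr1 (fun w => w *m _) (esym (mul_jacobian _ _ _))) _.
exact/esym/mulmxA.
Qed.

Lemma jacobian_id d (x : 'rV[R]_d) : jacobian id x = 1%:M.
Proof.
apply: row_vector_mx_inj => v; rewrite mulmx1; apply: etrans (mul_jacobian _ _ _) _.
by rewrite -deriveE ?derive_id.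
Qed.

Lemma smooth_at_jacobian d e (f : 'rV[R]_d -> 'rV[R]_e) x :
  smooth_at f x -> smooth_at (jacobian f) x.
Proof.
move=> sf; apply/smooth_at_mx => i j.
apply: (@smooth_at_near_eq _ _ _ (fun z => 'D_(delta_mx 0 i) f z 0 j)).
  apply: filterS (smooth_at_near sf) => z /smooth_at_differentiable df.
  by rewrite (jacobianE _ _ df).
exact: ((smooth_at_mx _ _).1 (smooth_at_derive _ sf)).
Qed.

End Jacobians.

Section Charts.
Variables (R : realType) (d : nat) (M : manifold R d).
Implicit Types (p q x : M).

Lemma near_dom p x : dom p x -> \forall y \near x, dom p y.
Proof. by move=> px; apply: open_nbhs_nbhs; split=> //; exact: dom_open. Qed.

Lemma near_param p x (P : M -> Prop) : dom p x ->
  (\forall y \near x, P y) -> \forall z \near chart p x, P (param p z).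
Proof.
move=> px nP; have : param p @ chart p x --> x by rewrite -[X in _ --> X](chartK px); exact: param_continuous.
by apply.
Qed.

Lemma near_chart p x (P : 'rV[R]_d -> Prop) : dom p x ->
  (\forall z \near chart p x, P z) -> \forall y \near x, P (chart p y).
Proof. by move=> px nP; exact: (chart_continuous px). Qed.

Lemma near_paramK p x : dom p x -> \forall z \near chart p x,
  chart p (param p z) = z.
Proof.
move=> px; have : \forall z \near chart p x, (chart p @` dom p) z.
  by apply: open_nbhs_nbhs; split; [exact: chart_open|exists x].
by apply: filterS => z [y py <-]; rewrite chartK.
Qed.

End Charts.

(** The charts at a and b stay fixed while the point moves, unlike in [tangent_map], where they move
    with it. *)
Definition loc (R : realType) d e (M : manifold R d) (N : manifold R e)
    (F : M -> N) (a : M) (b : N) := chart b \o F \o param a.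

Section ChainRule.
Variables (R : realType) (d e k : nat).
Variables (M : manifold R d) (N : manifold R e) (Q : manifold R k).

Lemma loc_chart (F : M -> N) a b x : dom a x -> loc F a b (chart a x) = chart b (F x).
Proof. by move=> ax; rewrite /loc /= chartK. Qed.

Lemma near_loc_comp (F : M -> N) (G : N -> Q) a b c x :
  dom a x -> dom b (F x) -> {for x, continuous F} ->
  \forall z \near chart a x, (loc G b c \o loc F a b) z = loc (G \o F) a c z.
Proof.
move=> ax bx cF.
have : \forall y \near x, dom b (F y) by apply: cF; exact: near_dom.
move/(near_param ax); apply: filterS => z /= bz.
by rewrite /loc /= chartK.
Qed.

Lemma jacobian_loc_comp (F : M -> N) (G : N -> Q) a b c x :
  dom a x -> dom b (F x) -> {for x, continuous F} ->
  differentiable (loc F a b) (chart a x) ->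
  differentiable (loc G b c) (chart b (F x)) ->
  differentiable (loc (G \o F) a c) (chart a x) /\
  jacobian (loc (G \o F) a c) (chart a x) =
  jacobian (loc F a b) (chart a x) *m jacobian (loc G b c) (chart b (F x)).
Proof.
move=> ax bx cF dF dG; have nE := near_loc_comp G c ax bx cF.
have dG' : differentiable (loc G b c) (loc F a b (chart a x)) by rewrite loc_chart.
have dGF : differentiable (loc G b c \o loc F a b) (chart a x).
  exact: differentiable_comp.
split; first exact: near_eq_differentiable nE dGF.
apply: etrans (esym (jacobian_near_eq nE dGF)) _.
apply: etrans (jacobian_comp dF dG') _.
exact: (congr1 (fun y => _ *m jacobian _ y) (loc_chart F b ax)).
Qed.

End ChainRule.

Section ChangeOfChart.
Variables (R : realType) (d : nat) (M : manifold R d).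
Implicit Types (p q x : M).

Lemma transition_differentiable p q x : dom p x -> dom q x ->
  differentiable (loc (fun y : M => y) p q) (chart p x).
Proof. by move=> px qx; exact/smooth_at_differentiable/transition_smooth. Qed.

(** Transition maps are local expressions of the identity, so the cocycle rule is an instance of the
    chain rule. *)
Lemma change_chartM a b c x : dom a x -> dom b x -> dom c x ->
  change_chart a b x *m change_chart b c x = change_chart a c x.
Proof.
move=> ax bx cx; have [] := @jacobian_loc_comp _ _ _ _ _ _ M (fun y : M => y)
  (fun y : M => y) a b c x ax bx (@cvg_id _ _)
  (transition_differentiable ax bx) (transition_differentiable bx cx).
by move=> _ /esym.
Qed.

Lemma change_chart_id p x : dom p x -> change_chart p p x = 1%:M.
Proof.
move=> px; apply: etrans _ (jacobian_id (chart p x)); apply: jacobian_near_eq.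
  exact: near_paramK.
exact: transition_differentiable.
Qed.

Lemma change_chartK a b x : dom a x -> dom b x ->
  change_chart a b x *m change_chart b a x = 1%:M.
Proof.
by move=> ax bx; exact: etrans (change_chartM ax bx ax) (change_chart_id ax).
Qed.

Lemma extend_self p v : extend p v p = v :> 'rV[R]_d.
Proof. by rewrite /extend change_chart_id ?mulmx1 //; exact: dom_mem. Qed.

End ChangeOfChart.

(** The link between moving and fixed charts: F is composed with the identity on both sides, each
    time with a change of chart, and the chain rule is applied twice. *)
Lemma tangent_map_chart (R : realType) d e (M : manifold R d) (N : manifold R e)
    (F : M -> N) a b x : map_smooth F -> dom a x -> dom b (F x) ->
  jacobian (loc F a b) (chart a x) =
  change_chart a x x *m tangent_map F x *m change_chart (F x) b (F x).
Proof.
move=> sF ax bx; have [cF /smooth_at_differentiable dF] := sF x.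
have xx := dom_mem x; have Fx := dom_mem (F x).
have [dF' E'] := @jacobian_loc_comp _ _ _ _ M N N F (fun y : N => y) x (F x) b x
  xx Fx cF dF (transition_differentiable Fx bx).
have [_ E] := @jacobian_loc_comp _ _ _ _ M M N (fun y : M => y) F a x b x
  ax xx (@cvg_id _ _) (transition_differentiable ax xx) dF'.
apply: etrans E (etrans _ (mulmxA _ _ _)).
exact: (congr1 (mulmx _) E').
Qed.

(** * Connections in coordinate frames *)

Section Sections.
Variables (R : realType) (d e : nat) (M : manifold R d) (N : manifold R e).
Variable F : M -> N.
Implicit Types (p x : M) (V W : M -> 'rV[R]_e).

Definition section_expr V p : 'rV[R]_d -> 'rV[R]_e :=
  (fun x => V x *m change_chart (F x) (F p) (F x)) \o param p.

Lemma section_near_eq V W p : (\forall x \near p, V x = W x) ->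
  section_smooth_at F V p -> section_smooth_at F W p.
Proof.
move=> VW; apply: smooth_at_near_eq.
have := near_param (dom_mem p) VW; apply: filterS => z E.
by rewrite /= E.
Qed.

Lemma section_expr_chart V p : section_expr V p (chart p p) = V p.
Proof.
rewrite /section_expr /= chartK; last exact: dom_mem.
by rewrite change_chart_id ?mulmx1 //; exact: dom_mem.
Qed.

Lemma section_expand V p : {for p, continuous F} ->
  \forall x \near p, V x = extend (F p) (section_expr V p (chart p x)) (F x).
Proof.
move=> cF; have nF : \forall x \near p, dom (F p) (F x).
  by apply: cF; exact/near_dom/dom_mem.
apply: filterS2 nF (near_dom (dom_mem p)) => x Fx px.
rewrite /section_expr /extend /= chartK // -mulmxA.
by rewrite change_chartK ?mulmx1 //; exact: dom_mem.
Qed.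

Lemma section_expr_extend w p : {for p, continuous F} ->
  \forall z \near chart p p, section_expr (fun x => extend (F p) w (F x)) p z = w.
Proof.
move=> cF; have nF : \forall x \near p, dom (F p) (F x).
  by apply: cF; exact/near_dom/dom_mem.
have := near_param (dom_mem p) nF; apply: filterS => z Fz.
rewrite /section_expr /extend /= -mulmxA.
by rewrite change_chartK ?mulmx1 //; exact: dom_mem.
Qed.

Lemma section_smooth_extend w p : {for p, continuous F} ->
  section_smooth_at F (fun x => extend (F p) w (F x)) p.
Proof.
move=> cF; apply: smooth_at_near_eq (smooth_at_cst w _).
by apply: filterS (section_expr_extend w cF) => z /esym.
Qed.

Lemma section_smooth_comb (c : M -> R) V p :
  fun_smooth_at c p -> section_smooth_at F V p ->
  section_smooth_at F (fun x => c x *: V x) p.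
Proof.
move=> sc /smooth_at_mx sV; apply/smooth_at_mx => i j.
have := smooth_atM sc (sV i j); congr (smooth_at _ _).
by apply/funext => z; rewrite /= -scalemxAl [RHS]mxE.
Qed.

Lemma section_smoothD V W p :
  section_smooth_at F V p -> section_smooth_at F W p ->
  section_smooth_at F (fun x => V x + W x) p.
Proof.
move=> sV sW; have := smooth_atD sV sW; congr (smooth_at _ _).
by apply/funext => z; rewrite /= -mulmxDl.
Qed.

Lemma section_smooth0 p : section_smooth_at F (fun _ => 0) p.
Proof.
apply: smooth_at_near_eq (@smooth_at_cst _ _ _ 0 _); near do by rewrite /= mul0mx.
Unshelve. all: by end_near. Qed.

End Sections.

Section ConnectionCalculus.
Variables (R : realType) (d e : nat) (M : manifold R d) (N : manifold R e).
Variables (F : M -> N) (D : M -> 'rV[R]_d -> (M -> 'rV[R]_e) -> 'rV[R]_e).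
Hypothesis conn : is_connection F D.
Implicit Types (p x : M) (v : 'rV[R]_d) (V W : M -> 'rV[R]_e).

(* Apply the Leibniz rule to the indicator function of a neighbourhood of p, which is smooth at p. *)
Lemma connection_local p v V W : section_smooth_at F V p ->
  (\forall x \near p, V x = W x) -> D p v V = D p v W.
Proof.
move=> sV VW; have sW := section_near_eq VW sV.
have [_ _ leib _] := conn.
pose f x : R := (`[< V x = W x >])%:R.
have f1 : \forall z \near chart p p, (f \o param p) z = 1.
  have := near_param (dom_mem p) VW; apply: filterS => z E.
  by rewrite /= /f asboolT.
have sf : fun_smooth_at f p.
  apply: smooth_at_near_eq (@smooth_at_cst _ _ _ (1 : R) _).
  by apply: filterS f1 => z ->.
have df : dirder f p v = 0.
  by apply: etrans (near_eq_derive v f1) _; exact: (@derive_cst _ _ R).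
have fp : f p = 1 by rewrite /f asboolT //; exact: nbhs_singleton VW.
have E : (fun x => f x *: V x) = (fun x => f x *: W x).
  apply/funext => x; rewrite /f; case: asboolP => [-> //|_].
  by rewrite !scale0r.
have := leib p v f V sf sV; rewrite E (leib p v f W sf sW) df fp.
by rewrite !scale0r !scale1r !add0r.
Qed.

Lemma connection0 p v : D p v (fun _ => 0) = 0.
Proof.
have [_ add _ _] := conn; have s0 := section_smooth0 F p.
have := add p v _ _ s0 s0; under [X in D p v X]eq_fun do rewrite addr0.
by move/eqP; rewrite -subr_eq0 opprD addNKr oppr_eq0 => /eqP.
Qed.

Lemma connection_sum (I : Type) (s : seq I) (c : I -> M -> R) (E : I -> M -> 'rV[R]_e) p v :
  (forall i, fun_smooth_at (c i) p) -> (forall i, section_smooth_at F (E i) p) ->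
  section_smooth_at F (fun x => \sum_(i <- s) c i x *: E i x) p /\
  D p v (fun x => \sum_(i <- s) c i x *: E i x) =
  \sum_(i <- s) (dirder (c i) p v *: E i p + c i p *: D p v (E i)).
Proof.
move=> sc sE; have [_ add leib _] := conn; elim: s => [|i s [IHs IH]].
  rewrite big_nil; under eq_fun do rewrite big_nil.
  by split; [exact: section_smooth0|rewrite connection0].
have si := section_smooth_comb (sc i) (sE i).
rewrite big_cons; under eq_fun do rewrite big_cons.
split; first exact: section_smoothD.
by rewrite add // IH leib.
Qed.

(** The connection form in the coordinate frame; when F is the identity, its entries are the
    Christoffel symbols contracted with v. *)
Definition conn_mx p v : 'M[R]_e :=
  \matrix_i D p v (fun x => extend (F p) (delta_mx 0 i) (F x)).

(** The local formula d + omega. The expansion of V in the coordinate frame holds only near p, so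
    locality must come before additivity and the Leibniz rule. *)
Lemma connectionE p v V : {for p, continuous F} -> section_smooth_at F V p ->
  D p v V = 'D_v (section_expr F V p) (chart p p) + V p *m conn_mx p v.
Proof.
move=> cF sV; pose c i x := section_expr F V p (chart p x) 0 i.
pose E i x : 'rV[R]_e := extend (F p) (delta_mx 0 i) (F x).
have cE i : \forall z \near chart p p, section_expr F V p z 0 i = (c i \o param p) z.
  by apply: filterS (near_paramK (dom_mem p)) => z E0; rewrite /= /c E0.
have sc i : fun_smooth_at (c i) p.
  by apply: smooth_at_near_eq (cE i) _; exact: (smooth_at_mx _ _).1.
have sE i : section_smooth_at F (E i) p by exact: section_smooth_extend.
have VE : \forall x \near p, V x = \sum_i c i x *: E i x.
  apply: filterS (section_expand V cF) => x ->.
  rewrite {1}(row_sum_delta (section_expr F V p (chart p x))) /extend mulmx_suml.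
  by apply: eq_bigr => i _; rewrite -scalemxAl.
rewrite (connection_local _ sV VE).
have [_ ->] := @connection_sum _ (index_enum _) c E p v sc sE.
rewrite big_split /=; congr (_ + _).
  rewrite [RHS]row_sum_delta; apply: eq_bigr => i _.
  rewrite /E extend_self; congr (_ *: _).
  apply: etrans _ (esym (derive_entry _ _ _ (smooth_at_differentiable sV))).
  by apply: near_eq_derive; apply: filterS (cE i) => z /esym.
rewrite -[in RHS](section_expr_chart F) mulmx_sum_row; apply: eq_bigr => i _.
by rewrite rowK.
Qed.

End ConnectionCalculus.

Section ConnectionFrames.
Variables (R : realType) (d e : nat) (M : manifold R d) (N : manifold R e).
Variables (F : M -> N) (D : M -> 'rV[R]_d -> (M -> 'rV[R]_e) -> 'rV[R]_e).

Lemma connection_extend p u w : is_connection F D -> {for p, continuous F} ->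
  D p u (fun x => extend (F p) w (F x)) = w *m conn_mx F D p u.
Proof.
move=> conn cF; rewrite (connectionE conn) //; last exact: section_smooth_extend.
rewrite extend_self (near_eq_derive u (section_expr_extend w cF)).
by rewrite derive_cst add0r.
Qed.

End ConnectionFrames.

(** * Levi-Civita connections *)

Section LeviCivita.
Variables (R : realType) (d : nat) (M : manifold R d) (g : M -> 'M[R]_d).
Variable nabla : M -> 'rV[R]_d -> (M -> 'rV[R]_d) -> 'rV[R]_d.
Implicit Types (p x : M) (u v : 'rV[R]_d).

Lemma vfield_smooth_extend p v : vfield_smooth_at (extend p v) p.
Proof. exact: (@section_smooth_extend _ _ _ M M (fun x : M => x) v p (@cvg_id _ _)). Qed.

Lemma innerE p u v : inner g p u v = (u *m g p *m v^T) 0 0.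
Proof. by []. Qed.

(* The matrix of g in the coordinate frame of the chart at p. *)
Definition metric_expr p (z : 'rV[R]_d) : 'M[R]_d :=
  change_chart p (param p z) (param p z) *m g (param p z)
    *m (change_chart p (param p z) (param p z))^T.

Lemma metric_expr_entry p z i j : metric_expr p z i j =
  inner g (param p z) (extend p (delta_mx 0 i) (param p z))
                      (extend p (delta_mx 0 j) (param p z)).
Proof. by rewrite mx_entry innerE /metric_expr /extend trmx_mul !mulmxA. Qed.

Lemma metric_expr_chart p : metric_expr p (chart p p) = g p.
Proof.
have pp := dom_mem p.
by rewrite /metric_expr chartK // change_chart_id // trmx1 mulmx1 mul1mx.
Qed.

Hypothesis hg : riemannian_metric g.

Lemma smooth_metric_expr p : smooth_at (metric_expr p) (chart p p).
Proof.
have [_ _ sm] := hg; apply/smooth_at_mx => i j.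
have sE := vfield_smooth_extend p.
have := sm p _ _ (sE (delta_mx 0 i)) (sE (delta_mx 0 j)); congr (smooth_at _ _).
by apply/funext => z; rewrite metric_expr_entry.
Qed.

Hypothesis hlc : levi_civita g nabla.

Local Notation Gam := (conn_mx (fun x : M => x) nabla).

Lemma nabla_extend p u v : nabla p u (extend p v) = v *m Gam p u.
Proof.
by have [conn _ _] := hlc; exact: (connection_extend u v conn (@cvg_id _ _)).
Qed.

Lemma derive_metric_expr p u :
  'D_u (metric_expr p) (chart p p) = Gam p u *m g p + g p *m (Gam p u)^T.
Proof.
have [_ met _] := hlc; have sE := vfield_smooth_extend p.
apply/matrixP => i j.
apply: etrans (derive_entry _ _ _ (smooth_at_differentiable (smooth_metric_expr p))) _.
have -> : (fun z => metric_expr p z i j) =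
    (fun x => inner g x (extend p (delta_mx 0 i) x) (extend p (delta_mx 0 j) x)) \o param p.
  by apply/funext => z; rewrite metric_expr_entry.
apply: etrans (met p u _ _ (sE _) (sE _)) _.
rewrite !nabla_extend !extend_self !innerE [RHS]mxE; congr (_ + _).
  by rewrite [RHS]mx_entry !mulmxA.
by rewrite [RHS]mx_entry trmx_mul !mulmxA.
Qed.

(** [dirder f x] reads f in the chart at x, and [extend p v x] has been converted to that chart; the
    chain rule for the transition map cancels the two conversions. Coordinate fields thereby act as
    directional derivatives in one chart. *)
Lemma dirder_extend p (f : M -> R) v : fun_smooth_at f p ->
  \forall x \near p, dirder f x (extend p v x) = 'D_v (f \o param p) (chart p x).
Proof.
move=> sf; have pp := dom_mem p.
apply: filterS2 (near_dom pp) (near_chart pp (smooth_at_near sf)) => x px.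
move=> /smooth_at_differentiable df; have xx := dom_mem x.
have dt := transition_differentiable xx px.
have E : \forall z \near chart x x,
    ((f \o param p) \o loc (fun y : M => y) x p) z = (f \o param x) z.
  have := near_param xx (near_dom px); apply: filterS => z pz.
  by rewrite /loc /= chartK.
have df' : differentiable (f \o param p) (loc (fun y : M => y) x p (chart x x)).
  by rewrite loc_chart.
have dv : 'd (loc (fun y : M => y) x p) (chart x x) (extend p v x) = v.
  apply: etrans (esym (mul_jacobian _ _ _)) _.
  have := change_chartK px xx; rewrite /extend -mulmxA => H.
  by apply: etrans (congr1 (mulmx v) H) (mulmx1 v).
apply: etrans (esym (near_eq_derive _ E)) _.
apply: etrans (deriveE _ (differentiable_comp dt df')) _.
apply: etrans (congr1 (fun h : _ -> _ => h _) (diff_comp dt df')) _.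
apply: etrans (congr1 ('d _ _) dv) _; apply: etrans (esym (deriveE v df')) _.
exact: (congr1 ('D_v _) (loc_chart _ _ xx)).
Qed.

Lemma torsion_expr p (f : M -> R) u v : fun_smooth_at f p ->
  dirder f p (v *m Gam p u - u *m Gam p v) =
  'D_u ('D_v (f \o param p)) (chart p p) - 'D_v ('D_u (f \o param p)) (chart p p).
Proof.
move=> sf; have [_ _ tor] := hlc; have sE := vfield_smooth_extend p.
have := tor p (extend p u) (extend p v) f (sE u) (sE v) sf.
rewrite !extend_self !nabla_extend => ->.
have D2 w w' : dirder (fun x => dirder f x (extend p w x)) p w' =
    'D_w' ('D_w (f \o param p)) (chart p p).
  have pp := dom_mem p.
  apply: near_eq_derive; have := near_param pp (dirder_extend w sf).
  apply: filterS2 (near_paramK pp) => z E H.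
  by apply: etrans H _; rewrite E.
by rewrite !D2.
Qed.

(** Torsion-freeness is tested on the coordinate functions of the chart at p: they separate tangent
    vectors, and their second derivatives vanish, so no symmetry of second derivatives has to be
    known beforehand. *)
Lemma levi_civita_sym p u v : v *m Gam p u = u *m Gam p v.
Proof.
apply/eqP; rewrite -subr_eq0; apply/eqP/rowP => i.
pose f x : R := chart p x 0 i; have pp := dom_mem p.
have fE : \forall z \near chart p p, (fun z : 'rV[R]_d => z 0 i) z = (f \o param p) z.
  by apply: filterS (near_paramK pp) => z E; rewrite /f /= E.
have Dcoord w z : 'D_w (fun z : 'rV[R]_d => z 0 i) z = w 0 i.
  rewrite -(@derive_entry _ _ _ _ (fun z : 'rV[R]_d => z)) ?derive_id //.
have scoord (z : 'rV[R]_d) : smooth_at (fun z : 'rV[R]_d => z 0 i : R) z.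
  exact: (smooth_at_mx id z).1 (smooth_at_id z) 0 i.
have sf : fun_smooth_at f p by exact: smooth_at_near_eq fE (scoord _).
have D2 w w' : 'D_w' ('D_w (f \o param p)) (chart p p) = 0.
  apply: etrans (near_eq_derive (g := cst (w 0 i)) w' _) _.
    have := near_join fE; apply: filterS => z Ez.
    by rewrite -(near_eq_derive w Ez) Dcoord.
  exact: (@derive_cst _ _ R).
have := torsion_expr u v sf; rewrite !D2 subr0 /dirder.
by rewrite -(near_eq_derive _ fE) Dcoord => ->; rewrite mxE.
Qed.

(* Torsion-freeness of any connection already forces the symmetry of second derivatives. *)
Lemma derive_sym p (f : M -> R) u v : fun_smooth_at f p ->
  'D_u ('D_v (f \o param p)) (chart p p) = 'D_v ('D_u (f \o param p)) (chart p p).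
Proof.
move=> sf; apply/eqP; rewrite -subr_eq0 -torsion_expr // levi_civita_sym subrr.
by rewrite /dirder derive0.
Qed.

End LeviCivita.

(** * Horizontally conformal submersions *)

Section FrameChange.
Variables (R : realType) (d e : nat).

Lemma invmx_uniq k (A B : 'M[R]_k) : A *m B = 1%:M -> invmx A = B.
Proof. by move=> AB; rewrite -[LHS]mulmx1 -AB mulKmx //; case: (mulmx1_unit AB). Qed.

(** The projection depends only on the metric and the kernel: a change of target frame cancels, and
    a change of source frame conjugates. *)
Lemma hmx_frame (C Ci g : 'M[R]_d) (A : 'M[R]_(d, e)) (C' C'i : 'M[R]_e) :
  g^T = g -> (forall v : 'rV[R]_d, v != 0 -> 0 < (v *m g *m v^T) 0 0) -> row_full A ->
  C *m Ci = 1%:M -> C' *m C'i = 1%:M ->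
  hmx (C *m g *m C^T) (C *m A *m C') = C *m hmx g A *m Ci.
Proof.
move=> gs gp fA CCi C'C'i.
have gu := posdef_unitmx gp; have Su := gramV_unitmx gs gp fA.
have CiC := mulmx1C CCi; have C'iC' := mulmx1C C'C'i.
have CT : C^T *m Ci^T = 1%:M by rewrite -trmx_mul CiC trmx1.
have C'T : C'^T *m C'i^T = 1%:M by rewrite -trmx_mul C'iC' trmx1.
have C'iT : C'i^T *m C'^T = 1%:M by rewrite -trmx_mul C'C'i trmx1.
have inv1 : invmx (C *m g *m C^T) = Ci^T *m invmx g *m Ci.
  apply: invmx_uniq; rewrite !mulmxA -(mulmxA _ C^T) CT mulmx1.
  by rewrite mulmxK.
rewrite !hmxE inv1.
have -> : (C *m A *m C')^T *m (Ci^T *m invmx g *m Ci) *m (C *m A *m C')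
    = C'^T *m (A^T *m invmx g *m A) *m C'.
  rewrite !trmx_mul !mulmxA -(mulmxA _ Ci C) CiC mulmx1.
  by rewrite -(mulmxA _ C^T Ci^T) CT mulmx1.
move: (A^T *m invmx g *m A) Su => S Su.
have -> : invmx (C'^T *m S *m C') = C'i *m invmx S *m C'i^T.
  apply: invmx_uniq; rewrite !mulmxA -(mulmxA _ C' C'i) C'C'i mulmx1.
  by rewrite mulmxK.
rewrite !trmx_mul !mulmxA -(mulmxA _ C' C'i) C'C'i mulmx1.
rewrite -(mulmxA _ C'i^T) C'iT mulmx1.
by rewrite -(mulmxA _ C^T Ci^T) CT mulmx1.
Qed.

Lemma conformal_frame (C Ci g : 'M[R]_d) (A : 'M[R]_(d, e)) (C' C'i K : 'M[R]_e) c :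
  g^T = g -> (forall v : 'rV[R]_d, v != 0 -> 0 < (v *m g *m v^T) 0 0) -> row_full A ->
  C *m Ci = 1%:M -> C' *m C'i = 1%:M ->
  A *m K *m A^T = c *: (hmx g A *m g) ->
  (C *m A *m C') *m (C'i *m K *m C'i^T) *m (C *m A *m C')^T =
  c *: (hmx (C *m g *m C^T) (C *m A *m C') *m (C *m g *m C^T)).
Proof.
move=> gs gp fA CCi C'C'i E; rewrite (hmx_frame gs gp fA CCi C'C'i).
have CiC := mulmx1C CCi.
rewrite !trmx_mul !mulmxA -(mulmxA _ C' C'i) C'C'i mulmx1.
have C'iT : C'i^T *m C'^T = 1%:M by rewrite -trmx_mul C'C'i trmx1.
rewrite -(mulmxA _ C'i^T) C'iT mulmx1.
rewrite -(mulmxA _ Ci C) CiC mulmx1.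
by rewrite -(mulmxA C A K) -(mulmxA C) E -scalemxAr -scalemxAl !mulmxA.
Qed.

End FrameChange.

Section MapGeometry.
Variables (R : realType) (d e : nat) (M : manifold R d) (N : manifold R e).
Variables (gM : M -> 'M[R]_d) (gN : N -> 'M[R]_e).
Variables (nablaM : M -> 'rV[R]_d -> (M -> 'rV[R]_d) -> 'rV[R]_d).
Variables (nablaN : N -> 'rV[R]_e -> (N -> 'rV[R]_e) -> 'rV[R]_e).
Variables (nablaF : M -> 'rV[R]_d -> (M -> 'rV[R]_e) -> 'rV[R]_e).
Variables (F : M -> N) (lam : M -> R).
Hypotheses (hgM : riemannian_metric gM) (hgN : riemannian_metric gN).
Hypotheses (hnablaM : levi_civita gM nablaM) (hnablaN : levi_civita gN nablaN).
Hypothesis hnablaF : is_pullback_connection F nablaN nablaF.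
Hypotheses (hF : submersion F) (hconf : horizontally_conformal gM gN lam F).

Let gMs x : (gM x)^T = gM x.
Proof. by have [] := hgM. Qed.

Let gMp x (v : 'rV[R]_d) : v != 0 -> 0 < (v *m gM x *m v^T) 0 0.
Proof. by have [_ H _] := hgM; exact: H. Qed.

Let sF : map_smooth F.
Proof. by have [] := hF. Qed.

Let fF x : row_full (tangent_map F x).
Proof. by have [] := hF. Qed.

Local Notation H x := (hmx (gM x) (tangent_map F x)).

Lemma hprojE x : hproj gM F x = H x.
Proof. exact: (proj_horizontal (gMs x) (@gMp x) (fF x)). Qed.

Lemma vprojE x : vproj gM F x = 1%:M - H x.
Proof. exact: (proj_vertical (gMs x) (@gMp x) (fF x)). Qed.

Lemma conformalE x :
  tangent_map F x *m gN (F x) *m (tangent_map F x)^T =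
  lam x ^+ 2 *: (H x *m gM x).
Proof.
apply: (conformal_hmx (gMs x) (@gMp x) (fF x)) => u v hu hv.
by have [_] := hconf; exact.
Qed.

Variable p : M.

Local Notation q := (F p).
Local Notation z0 := (chart p p).
Local Notation A := (tangent_map F p).
Local Notation GamM := (conn_mx (fun x : M => x) nablaM p).
Local Notation GamN := (conn_mx (fun y : N => y) nablaN q).

(** Together with [metricN_expr] and [H_expr], these are the fixed-chart versions of the
    differential, the metric of N along F and the horizontal projection, and they are what gets
    differentiated below. *)
Definition dF_expr : 'rV[R]_d -> 'M[R]_(d, e) := jacobian (loc F p q).

Definition metricN_expr z := metric_expr gN q (loc F p q z).

Definition H_expr z := hmx (metric_expr gM p z) (dF_expr z).

Let nF : \forall z \near z0,
  [/\ dom p (param p z), dom q (F (param p z)) & chart p (param p z) = z].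
Proof.
have pp := dom_mem p; have [cF _] := sF p.
have n1 : \forall x \near p, dom q (F x) by apply: cF; exact/near_dom/dom_mem.
apply: filterS3 (near_param pp (near_dom pp)) (near_param pp n1) (near_paramK pp).
by move=> z.
Qed.

Lemma dF_expr_near : \forall z \near z0, let x := param p z in
  dF_expr z = change_chart p x x *m tangent_map F x *m change_chart (F x) q (F x).
Proof.
apply: filterS nF => z [px qx zE] x.
have := tangent_map_chart sF px qx; rewrite zE; exact.
Qed.

Lemma smooth_dF_expr : smooth_at dF_expr z0.
Proof. by apply: smooth_at_jacobian; have [] := sF p. Qed.

Lemma frames_near : \forall z \near z0, let x := param p z in
  change_chart p x x *m change_chart x p x = 1%:M /\
  change_chart (F x) q (F x) *m change_chart q (F x) (F x) = 1%:M.
Proof.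
apply: filterS nF => z [px qx zE] x.
by split; apply: change_chartK => //; exact: dom_mem.
Qed.

Lemma metricN_near : \forall z \near z0, let x := param p z in
  metricN_expr z = change_chart q (F x) (F x) *m gN (F x) *m (change_chart q (F x) (F x))^T.
Proof.
apply: filterS nF => z [px qx zE] x.
rewrite /metricN_expr /metric_expr.
have -> : param q (loc F p q z) = F x by rewrite /loc /= chartK.
by [].
Qed.

Lemma conformal_near : \forall z \near z0,
  dF_expr z *m metricN_expr z *m (dF_expr z)^T =
  lam (param p z) ^+ 2 *: (H_expr z *m metric_expr gM p z).
Proof.
apply: filterS3 dF_expr_near metricN_near frames_near => z.
rewrite /H_expr => /= -> -> [c1 c2]; rewrite /metric_expr.
exact: (conformal_frame (@gMs _) (@gMp _) (@fF _) c1 c2 (conformalE _)).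
Qed.

Lemma vproj_near v : \forall z \near z0,
  section_expr (fun x : M => x) (fun x => extend p v x *m vproj gM F x) p z =
  v *m (1%:M - H_expr z).
Proof.
apply: filterS2 dF_expr_near frames_near => z.
rewrite /H_expr => /= -> [c1 c2]; rewrite /metric_expr.
rewrite (hmx_frame (@gMs _) (@gMp _) (@fF _) c1 c2).
rewrite /section_expr /extend /= vprojE.
move: (change_chart _ _ _) (change_chart _ _ _) (hmx _ _) c1 => C C' h c1.
by rewrite -!mulmxA; congr (v *m _); rewrite mulmxBl mulmxBr mul1mx c1 mulmxA.
Qed.

Lemma dF_expr_center : dF_expr z0 = A.
Proof. by []. Qed.

Lemma H_expr_center : H_expr z0 = H p.
Proof. by rewrite /H_expr metric_expr_chart. Qed.

Lemma smooth_H_expr : smooth_at H_expr z0.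
Proof.
have sG := smooth_metric_expr hgM p; have sA := smooth_dF_expr.
have sGi : smooth_at (fun z => invmx (metric_expr gM p z)) z0.
  apply: smooth_at_invmx => //; rewrite metric_expr_chart; exact: posdef_unitmx (@gMp p).
have -> : H_expr = fun z => dF_expr z *m invmx ((dF_expr z)^T *m invmx (metric_expr gM p z)
    *m dF_expr z) *m (dF_expr z)^T *m invmx (metric_expr gM p z).
  by apply/funext => z; rewrite /H_expr hmxE.
apply: (smooth_at_mulmx _ sGi); apply: (smooth_at_mulmx _ (smooth_at_trmx sA)).
apply: (smooth_at_mulmx sA); apply: smooth_at_invmx.
  by rewrite metric_expr_chart dF_expr_center; exact: (gramV_unitmx (gMs p) (@gMp p) (fF p)).
apply: (smooth_at_mulmx _ sA); apply: (smooth_at_mulmx _ sGi).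
exact: smooth_at_trmx.
Qed.

Lemma H_expr_near : \forall z \near z0,
  [/\ H_expr z *m dF_expr z = dF_expr z,
     H_expr z *m metric_expr gM p z = metric_expr gM p z
       - (1%:M - H_expr z) *m metric_expr gM p z *m (1%:M - H_expr z)^T,
     \tr (H_expr z) = e%:R
   & metric_expr gM p z \in unitmx].
Proof.
apply: filterS2 dF_expr_near frames_near => z.
rewrite /H_expr => /= -> [c1 c2]; rewrite /metric_expr.
move: (gMs (param p z)) (@gMp (param p z)) (fF (param p z)) c1 c2.
move: (gM _) (tangent_map _ _) => g a gs gp fa.
move: (change_chart _ _ _) (change_chart _ _ _) => Ci C.
move: (change_chart _ _ _) (change_chart _ _ _) => C'i C' c1 c2.
have uC : C \in unitmx by case: (mulmx1_unit c1).
have uC' : C' \in unitmx by case: (mulmx1_unit c2).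
have Gs : (C *m g *m C^T)^T = C *m g *m C^T by rewrite !trmx_mul trmxK gs mulmxA.
have Gp (v : 'rV[R]_d) : v != 0 -> 0 < (v *m (C *m g *m C^T) *m v^T) 0 0.
  move=> v0; have := gp (v *m C); rewrite trmx_mul !mulmxA; apply.
  by apply: contra_neq v0 => E; rewrite -(mulmxK uC v) E mul0mx.
have fA : row_full (C *m a *m C').
  by rewrite /row_full mxrankMfree ?row_free_unit // (eqmxMfull _ _) // row_full_unit.
split; [exact: (hmxA Gs Gp fA)|exact: (hmx_sandwich Gs Gp fA)|
        exact: (mxtrace_hmx Gs Gp fA)|exact: (posdef_unitmx Gp)].
Qed.

(** * The second fundamental form of F in coordinates *)

Lemma conn_mx_pullback u : conn_mx F nablaF p u = GamN (u *m A).
Proof.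
have [_ pull] := hnablaF; apply/row_matrixP => i; rewrite !rowK.
by apply: pull; exact: vfield_smooth_extend.
Qed.

(** The classical coordinate Hessian of a map: second derivatives of F, plus the Christoffel term of
    N along F, minus that of M. The direction u is fixed and the other argument multiplies from the
    left. *)
Definition Bmx u : 'M[R]_(d, e) :=
  'D_u dF_expr z0 + A *m GamN (u *m A) - GamM u *m A.

Let dA := smooth_at_differentiable smooth_dF_expr.

Lemma section_expr_dF v : \forall z \near z0,
  section_expr F (fun x => extend p v x *m tangent_map F x) p z = v *m dF_expr z.
Proof.
apply: filterS dF_expr_near => z /= ->.
by rewrite /section_expr /extend /= !mulmxA.
Qed.

Lemma second_fundamental_form_extend u v :
  second_fundamental_form nablaM nablaF F (extend p u) (extend p v) p = v *m Bmx u.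
Proof.
have [conn _] := hnablaF; have [cF _] := sF p.
rewrite /second_fundamental_form !extend_self (nabla_extend hnablaM).
have nV := section_expr_dF v.
have sV : section_smooth_at F (fun x => extend p v x *m tangent_map F x) p.
  apply: (@smooth_at_near_eq _ _ _ (fun z => v *m dF_expr z)).
    by apply: filterS nV => z /esym.
  exact: (smooth_at_mulmx (smooth_at_cst v z0) smooth_dF_expr).
rewrite (connectionE conn u cF sV) (near_eq_derive u nV) (derive_mulmxl v u dA).
by rewrite extend_self conn_mx_pullback /Bmx mulmxBr mulmxDr !mulmxA.
Qed.

Lemma derive_dF_sym u v : v *m 'D_u dF_expr z0 = u *m 'D_v dF_expr z0.
Proof.
(* Each component of F in the chart at F p is a function on M, so the symmetry of second derivatives
   obtained from torsion-freeness on M applies to it. *)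
apply/rowP => a; pose f x : R := chart q (F x) 0 a.
have sL : smooth_at (loc F p q) z0 by have [] := sF p.
have sf : fun_smooth_at f p by exact: (smooth_at_mx _ _).1 sL 0 a.
have E w w' : (w *m 'D_w' dF_expr z0) 0 a = 'D_w' ('D_w (f \o param p)) z0.
  rewrite -(derive_mulmxl w w' dA).
  apply: etrans (derive_entry _ _ _ (differentiable_mulmx (differentiable_cst w z0) dA)) _.
  apply: near_eq_derive; apply: filterS (smooth_at_near sL) => z.
  move=> /smooth_at_differentiable dL.
  apply: etrans _ (derive_entry w 0 a dL).
  exact: (congr1 (fun m : 'rV[R]_e => m 0 a) (esym (deriveEjacobian w dL))).
exact: etrans (E v u) (etrans (derive_sym hnablaM u v sf) (esym (E u v))).
Qed.

Lemma Bmx_sym u v : v *m Bmx u = u *m Bmx v.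
Proof.
rewrite /Bmx !mulmxBr !mulmxDr derive_dF_sym !mulmxA.
by rewrite (levi_civita_sym hnablaN) (levi_civita_sym hnablaM).
Qed.

(* V = v P is a vertical field, so differentiating F_* V = 0 gives II(u, v) A = - B(u, v). *)
Lemma fibre_form_Bmx u v : v *m A = 0 ->
  fibre_second_fundamental_form gM nablaM F p u v *m A = - (v *m Bmx u).
Proof.
move=> vA; have [conn _ _] := hnablaM.
have vH : v *m H p = 0 by exact: ker_hmx.
have nV := vproj_near v.
have sP : smooth_at (fun z => v *m (1%:M - H_expr z)) z0.
  apply: smooth_at_mulmx; first exact: smooth_at_cst.
  by apply: smooth_at_subr; [exact: smooth_at_cst|exact: smooth_H_expr].
have sV : section_smooth_at (fun x : M => x) (fun x => extend p v x *m vproj gM F x) p.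
  by apply: smooth_at_near_eq sP; apply: filterS nV => z /esym.
rewrite /fibre_second_fundamental_form hprojE -mulmxA (hmxA (gMs p) (@gMp p) (fF p)).
rewrite (connectionE conn u (@cvg_id _ _) sV) (near_eq_derive u nV).
have : 'D_u (fun z => v *m (1%:M - H_expr z) *m dF_expr z) z0 = 0.
  apply: etrans (near_eq_derive (g := cst 0) u _) (derive_cst _ _ _).
  apply: filterS H_expr_near => z [Hd _ _ _].
  by rewrite -mulmxA mulmxBl mul1mx Hd subrr mulmx0.
rewrite (derive_mulmx u (smooth_at_differentiable sP) dA) H_expr_center /Bmx.
move: ('D_u _ z0) ('D_u _ z0) => X Y.
rewrite extend_self vprojE mulmxBr mulmx1 vH subr0 mulmxDl => /eqP; rewrite addr_eq0 => /eqP ->.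
by rewrite mulmxBr mulmxDr !mulmxA vA mul0mx addr0 opprB addrC.
Qed.

(** * Derivatives of the pulled-back metric and of the dilation *)

Lemma derive_metricN_expr u : differentiable metricN_expr z0 /\
  'D_u metricN_expr z0 = GamN (u *m A) *m gN q + gN q *m (GamN (u *m A))^T.
Proof.
have dL : differentiable (loc F p q) z0.
  by apply: smooth_at_differentiable; have [] := sF p.
have Lz : loc F p q z0 = chart q q by exact: loc_chart (dom_mem p).
have dK : differentiable (metric_expr gN q) (loc F p q z0).
  by rewrite Lz; exact/smooth_at_differentiable/smooth_metric_expr.
have dC : differentiable metricN_expr z0 := differentiable_comp dL dK.
split=> //; rewrite -(derive_metric_expr hgN hnablaN) -Lz.
apply: etrans (deriveE _ dC) _; apply: etrans _ (esym (deriveE _ dK)).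
apply: etrans (congr1 (fun h : _ -> _ => h _) (diff_comp dL dK)) _.
exact: (congr1 ('d _ _) (esym (mul_jacobian _ _ _))).
Qed.

Lemma metricN_expr_center : metricN_expr z0 = gN q.
Proof. by rewrite /metricN_expr loc_chart ?metric_expr_chart //; exact: dom_mem. Qed.

Local Notation Phi := (fun z => dF_expr z *m metricN_expr z *m (dF_expr z)^T).

Lemma differentiable_Phi : differentiable Phi z0.
Proof.
have [dK _] := derive_metricN_expr 0.
exact: (differentiable_mulmx (differentiable_mulmx dA dK) (differentiable_trmx dA)).
Qed.

Lemma derive_Phi u :
  let S := 'D_u dF_expr z0 + A *m GamN (u *m A) in
  'D_u Phi z0 = S *m gN q *m A^T + A *m gN q *m S^T.
Proof.
have [dK DK] := derive_metricN_expr u.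
rewrite (derive_mulmx u (differentiable_mulmx dA dK) (differentiable_trmx dA)).
rewrite (derive_mulmx u dA dK) (derive_trmx u dA) DK metricN_expr_center dF_expr_center.
move: ('D_u _ z0) (GamN _) => X Y /=.
rewrite [(X + _)^T]linearD /= trmx_mul !mulmxDl !mulmxDr !mulmxDl !mulmxA.
by rewrite -!addrA; congr (_ + (_ + _)); rewrite addrC.
Qed.

Lemma derive_sandwich (X : 'rV[R]_d -> 'M[R]_d) z u (v w : 'rV[R]_d) :
  differentiable X z -> differentiable (fun z => (v *m X z *m w^T) 0 0) z /\
  'D_u (fun z => (v *m X z *m w^T) 0 0) z = (v *m 'D_u X z *m w^T) 0 0.
Proof.
move=> dX; have dv := differentiable_mulmx (differentiable_cst v z) dX.
have dvw := differentiable_mulmx dv (differentiable_cst w^T z).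
split; first exact: (differentiable_mxP _ _).1 dvw 0 0.
apply: etrans (esym (derive_entry _ _ _ dvw)) _.
by rewrite (derive_mulmxr w^T u dv) (derive_mulmxl v u dX).
Qed.

Hypothesis e_gt0 : (0 < e)%N.

(** Near p the pulled-back metric is lam^2 times the horizontal metric, whose trace is e. Dividing
    the trace by e gives lam^2 as a differentiable function, and the square root is differentiable
    since lam is positive. *)
Lemma differentiable_dilation : differentiable (lam \o param p) z0.
Proof.
pose T z := \tr (Phi z *m invmx (metric_expr gM p z)).
have e0 : e%:R != 0 :> R by rewrite pnatr_eq0 -lt0n.
have lam0 x : 0 < lam x by have [] := hconf.
have dT : differentiable T z0.
  apply: differentiable_mxtrace; apply: differentiable_mulmx differentiable_Phi _.
  apply: smooth_at_differentiable; apply: smooth_at_invmx; last exact: smooth_metric_expr.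
  by rewrite metric_expr_chart; exact: posdef_unitmx (@gMp p).
have TE : \forall z \near z0, T z * e%:R^-1 = lam (param p z) ^+ 2.
  apply: filterS2 conformal_near H_expr_near => z E [_ _ trH Gu].
  by rewrite /T E -scalemxAl mulmxK // mxtraceZ trH mulfK.
have T0 : 0 < T z0 * e%:R^-1 by rewrite (nbhs_singleton TE) exprn_gt0.
apply: (@near_eq_differentiable _ _ _ (Num.sqrt \o (fun z => T z * e%:R^-1))).
  by apply: filterS TE => z /= ->; rewrite sqrtr_sqr gtr0_norm.
apply: differentiable_comp; first by apply: differentiableM.
by apply/derivable1_diffP; have [] := is_derive1_sqrt T0.
Qed.

Definition dlam : 'cV[R]_d := \col_i dirder lam p (delta_mx 0 i).

Lemma dirder_dilation u : dirder lam p u = (u *m dlam) 0 0.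
Proof.
have dl := differentiable_dilation; rewrite /dirder.
have E w : 'D_w (lam \o param p) z0 = 'd (lam \o param p) z0 w by exact: deriveE.
rewrite E [u in LHS]row_sum_delta linear_sum mxE; apply: eq_bigr => i _.
by rewrite linearZ /= -E mxE.
Qed.

(* The pulled-back metric is lam^2 (g - P g P^T) with P the vertical projection; as v P and
   w P vanish at p, the second summand does not contribute to the derivative. *)
Lemma conformal_derivative (u v w : 'rV[R]_d) : v *m H p = v -> w *m H p = w ->
  (v *m Bmx u *m gN q *m (w *m A)^T) 0 0 + (w *m Bmx u *m gN q *m (v *m A)^T) 0 0 =
  2 * lam p * (u *m dlam) 0 0 * (v *m gM p *m w^T) 0 0.
Proof.
move=> vH wH; have dl := differentiable_dilation.
have dG := smooth_at_differentiable (smooth_metric_expr hgM p).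
have sP : smooth_at (fun z => 1%:M - H_expr z) z0.
  by apply: smooth_at_subr; [exact: smooth_at_cst|exact: smooth_H_expr].
have dP := smooth_at_differentiable sP.
have dPG := differentiable_mulmx dP dG.
have dPGP := differentiable_mulmx dPG (differentiable_trmx dP).
pose X z := metric_expr gM p z
  - (1%:M - H_expr z) *m metric_expr gM p z *m (1%:M - H_expr z)^T.
have dX : differentiable X z0 by exact: differentiableB.
have [dv0 DPhi] := derive_sandwich u v w differentiable_Phi.
have [dvX DX] := derive_sandwich u v w dX.
have near_E : \forall z \near z0, (v *m Phi z *m w^T) 0 0 =
    (lam \o param p) z * (lam \o param p) z * (v *m X z *m w^T) 0 0.
  apply: filterS2 conformal_near H_expr_near => z E [_ HX _ _].
  by rewrite /= E HX -scalemxAr -scalemxAl [LHS]mxE -expr2.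
have vP : v *m (1%:M - H p) = 0 by rewrite mulmxBr mulmx1 vH subrr.
have wP : (1%:M - H p)^T *m w^T = 0 by rewrite -trmx_mul mulmxBr mulmx1 wH subrr trmx0.
have DXE : (v *m 'D_u X z0 *m w^T) 0 0 =
    (v *m (GamM u *m gM p + gM p *m (GamM u)^T) *m w^T) 0 0.
  have -> : 'D_u X z0 = 'D_u (metric_expr gM p) z0 -
      'D_u (fun z => (1%:M - H_expr z) *m metric_expr gM p z *m (1%:M - H_expr z)^T) z0.
    exact: deriveB (diff_derivable dG) (diff_derivable dPGP).
  rewrite (derive_metric_expr hgM hnablaM) (derive_mulmx u dPG (differentiable_trmx dP)).
  rewrite H_expr_center metric_expr_chart; move: ('D_u _ z0) ('D_u _ z0) => Y Z.
  rewrite mulmxBr mulmxBl; set W := v *m _ *m _.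
  rewrite mulmxDr mulmxDl -!mulmxA wP !mulmx0 add0r (mulmxA v) vP mul0mx subr0 //.
have DE : (v *m 'D_u Phi z0 *m w^T) 0 0 =
    2 * lam p * (u *m dlam) 0 0 * (v *m gM p *m w^T) 0 0 +
    lam p ^+ 2 * (v *m (GamM u *m gM p + gM p *m (GamM u)^T) *m w^T) 0 0.
  pose l : 'rV[R]_d -> R := lam \o param p.
  pose s : 'rV[R]_d -> R := fun z => (v *m X z *m w^T) 0 0.
  have dl1 := @diff_derivable _ _ _ l z0 u dl; have ds1 := @diff_derivable _ _ _ s z0 u dvX.
  have DM : 'D_u (l * l * s) z0 = (l * l) z0 *: 'D_u s z0 + s z0 *: 'D_u (l * l) z0.
    exact: (deriveM (derivableM dl1 dl1) ds1).
  have Ds : 'D_u s z0 = _ := etrans DX DXE.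
  rewrite -DPhi; apply: etrans (near_eq_derive (g := l * l * s) u near_E) _.
  apply: etrans DM _; rewrite (deriveM dl1 dl1) Ds.
  have -> : s z0 = (v *m gM p *m w^T) 0 0.
    rewrite /s /X H_expr_center metric_expr_chart.
    by rewrite mulmxBr mulmxBl (mulmxA v) (mulmxA v) vP !mul0mx subr0.
  have lz : l z0 = lam p by rewrite /l /= chartK //; exact: dom_mem.
  have Dl : 'D_u l z0 = (u *m dlam) 0 0 := dirder_dilation u.
  rewrite Dl !fctE lz /GRing.scale /= -mulr2n.
  rewrite -mulr_natl expr2; move: (_ 0 0) (_ 0 0) (_ 0 0) => a b c.
  ring.
have [Ks _ _] := hgN; have cE := conformalE p.
(* The derivative of the metric of M leaves Christoffel terms scaled by lam^2. As v and w are
   horizontal, conformality rewrites them through the metric of N, and they become the terms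
   [GamM u *m A] that distinguish [Bmx] from the derivative of the pulled-back metric. *)
have Gw : lam p ^+ 2 *: (gM p *m w^T) = A *m gN q *m A^T *m w^T.
  by rewrite cE -scalemxAl (hmx_sym _ (gMs p) (@gMp p)) -mulmxA -trmx_mul wH.
have Gv : lam p ^+ 2 *: (v *m gM p) = v *m (A *m gN q *m A^T).
  by rewrite cE -scalemxAr mulmxA vH.
have GE : lam p ^+ 2 * (v *m (GamM u *m gM p + gM p *m (GamM u)^T) *m w^T) 0 0 =
    (v *m (GamM u *m A *m gN q *m A^T + A *m gN q *m (GamM u *m A)^T) *m w^T) 0 0.
  rewrite mulmxDr mulmxDl [in RHS]mulmxDr [in RHS]mulmxDl [X in _ * X]mxE [RHS]mxE mulrDr.
  congr (_ + _).
    have -> : v *m (GamM u *m A *m gN q *m A^T) *m w^T = v *m GamM u *m (A *m gN q *m A^T *m w^T).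
      by rewrite !mulmxA.
    by rewrite -Gw -scalemxAr [RHS]mxE !mulmxA.
  rewrite trmx_mul.
  have -> : v *m (A *m gN q *m (A^T *m (GamM u)^T)) *m w^T =
      v *m (A *m gN q *m A^T) *m (GamM u)^T *m w^T by rewrite !mulmxA.
  by rewrite -Gv -!scalemxAl [RHS]mxE !mulmxA.
rewrite derive_Phi GE in DE.
have -> : (w *m Bmx u *m gN q *m (v *m A)^T) 0 0 = (v *m A *m gN q *m (w *m Bmx u)^T) 0 0.
  by rewrite -[in RHS](trmxK (v *m A *m _ *m _)) [RHS]mxE !trmx_mul !trmxK Ks !mulmxA.
apply: (addIr ((v *m (GamM u *m A *m gN q *m A^T + A *m gN q *m (GamM u *m A)^T) *m w^T) 0 0)).
rewrite -{}DE /Bmx; move: ('D_u _ z0 + _) (GamM u *m A) => S T.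
have E (Y Z : 'M[R]_1) : Y 0 0 + Z 0 0 = (Y + Z) 0 0 by rewrite mxE.
rewrite !E; congr (_ 0 0).
rewrite !trmx_mul [(S - T)^T]linearB /= !(mulmxDr, mulmxDl, mulmxBr, mulmxBl) !mulmxA.
by rewrite !(mulmxN, mulNmx) addrACA !subrK.
Qed.

(** * The trace identity and the three conditions at a point *)

Local Notation mean :=
  (bitrace (gM p) (row_base (vertical F p)) (fibre_second_fundamental_form gM nablaM F p)).

Lemma tension_identity (w : 'rV[R]_d) : w *m H p = w ->
  (tension_field gM nablaM nablaF F p *m gN q *m (w *m A)^T) 0 0 =
  lam p * (2 - e%:R) * (w *m dlam) 0 0 - lam p ^+ 2 * (mean *m gM p *m w^T) 0 0.
Proof.
move=> wH; pose y : 'cV[R]_e := gN q *m (w *m A)^T.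
(* The form <B(u, v), F_* w>. Only the basis values enter the definition; linearity of [Bmx] in its
   direction then comes from the symmetry of B, which moves the direction to the left factor. *)
pose b : 'M[R]_d := \matrix_(i, j) (Bmx (delta_mx 0 j) *m y) i 0.
have bE (u v : 'rV[R]_d) : u *m b *m v^T = v *m Bmx u *m y.
  have -> : u *m b = (Bmx u *m y)^T.
    apply/rowP => j; rewrite [RHS]mxE [LHS]mxE.
    transitivity ((u *m Bmx (delta_mx 0 j) *m y) 0 0).
      by rewrite -mulmxA [RHS]mxE; apply: eq_bigr => i _; rewrite [b i j]mxE.
    by rewrite Bmx_sym -mulmxA -rowE mxE.
  by rewrite -trmx_mul -mulmxA; apply/matrixP => i j; rewrite !ord1 mxE.
(* Pulled back to M, the covector of F_* w is lam^2 times the covector of w; this is the factor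
   lam^2 before the mean curvature. *)
have cE : A *m y = lam p ^+ 2 *: (gM p *m w^T).
  rewrite /y trmx_mul !mulmxA conformalE -scalemxAl (hmx_sym _ (gMs p) (@gMp p)).
  by rewrite -mulmxA -trmx_mul wH.
have tauE : (tension_field gM nablaM nablaF F p *m y) 0 0 = \tr (invmx (gM p) *m b).
  rewrite /tension_field (bitrace_mul (gMs p) (b := b)).
    by rewrite trmx1 mulmx1 !mul1mx mulmx1.
  by move=> i j; rewrite second_fundamental_form_extend bE.
have meanE : (mean *m (A *m y)) 0 0 = - \tr (invmx (gM p) *m (1%:M - H p) *m b).
  rewrite (bitrace_mul (gMs p) (b := - b)).
    rewrite (row_base_inv_gram (gMs p) (@gMp p) (fF p)).
    by rewrite mulmxN linearN.
  move=> i j; rewrite mulmxN mulNmx bE mulmxA fibre_form_Bmx ?mulNmx //.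
  by apply/sub_kermxP; rewrite (submx_trans (row_sub _ _)) // eq_row_base.
(* Koszul's combination of the three cyclic instances of conformal_derivative. *)
have horiz (u v : 'rV[R]_d) : u *m H p = u -> v *m H p = v ->
    (u *m b *m v^T) 0 0 = lam p * ((u *m dlam) 0 0 * (v *m gM p *m w^T) 0 0
      + (v *m dlam) 0 0 * (u *m gM p *m w^T) 0 0
      - (w *m dlam) 0 0 * (u *m gM p *m v^T) 0 0).
  move=> uH vH; have h1 := conformal_derivative u vH wH.
  have h2 := conformal_derivative v uH wH; have h3 := conformal_derivative w uH vH.
  (* Symmetry identifies the six terms in pairs, after which h1 + h2 - h3 is twice the wanted
     term. *)
  rewrite (Bmx_sym u w) in h1; rewrite (Bmx_sym v u) (Bmx_sym v w) in h2.
  rewrite bE /y mulmxA; lra.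
have := tension_trace (gMs p) (@gMp p) (fF p) wH horiz.
rewrite -tauE => tE; rewrite -mulmxA tE -[X in X + _ = _]opprK -meanE cE.
by rewrite -scalemxAr [X in - X + _ = _]mxE mulmxA addrC.
Qed.

(** The horizontal part of the gradient represents the differential of the dilation on horizontal
    vectors. For the converse it is paired with itself, and positivity of the metric concludes. *)
Lemma homotheticP : grad gM lam p *m hproj gM F p = 0 <->
  forall w : 'rV[R]_d, w *m H p = w -> (w *m dlam) 0 0 = 0.
Proof.
have gE : grad gM lam p = dlam^T *m invmx (gM p).
  by rewrite /grad; congr (_ *m _); apply/rowP => i; rewrite !mxE.
have Gu := posdef_unitmx (@gMp p); have HK := hmxK (gMs p) (@gMp p) (fF p).
have pairing (w : 'rV[R]_d) : w *m H p = w ->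
    grad gM lam p *m H p *m gM p *m w^T = (w *m dlam)^T.
  move=> wH; rewrite gE -(mulmxA _ (H p)) (hmx_sym _ (gMs p) (@gMp p)).
  by rewrite !mulmxA mulmxKV // -mulmxA -trmx_mul wH -trmx_mul.
rewrite hprojE; split=> [g0 w /pairing|H0].
  by rewrite g0 !mul0mx => /matrixP /(_ 0 0); rewrite !mxE => <-.
apply/eqP; apply: contraT => /(@gMp p).
have gH : grad gM lam p *m H p *m H p = grad gM lam p *m H p by rewrite -mulmxA HK.
by rewrite (pairing _ gH) mxE H0 // ltxx.
Qed.

Lemma mean_hproj : mean *m H p = mean.
Proof.
rewrite /bitrace mulmx_suml; apply: eq_bigr => i _; rewrite mulmx_suml.
apply: eq_bigr => j _; rewrite -scalemxAl /fibre_second_fundamental_form hprojE.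
by move: (nablaM _ _ _) => X; rewrite -(mulmxA X) (hmxK (gMs p) (@gMp p) (fF p)).
Qed.

Lemma fibre_mean_curvature_eq0 :
  fibre_mean_curvature gM nablaM F p = 0 <-> mean = 0.
Proof.
rewrite /fibre_mean_curvature; split=> [|->]; last by rewrite scaler0.
move/eqP; rewrite scaler_eq0 invr_eq0 pnatr_eq0 => /orP[/eqP r0|/eqP //].
(* For fibres of dimension 0 the normalising factor is the inverse of 0, that is 0, but the trace is
   then an empty sum. *)
by apply: big1 => i _; have := ltn_ord i; rewrite {2}r0.
Qed.

Lemma mean_eq0 : (forall w : 'rV[R]_d, w *m H p = w -> (mean *m gM p *m w^T) 0 0 = 0) ->
  mean = 0.
Proof.
move=> H0; apply/eqP; apply: contraT => /(@gMp p).
by rewrite (H0 _ mean_hproj) ltxx.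
Qed.

Lemma tension_eq0 (t : 'rV[R]_e) :
  (forall w : 'rV[R]_d, w *m H p = w -> (t *m gN q *m (w *m A)^T) 0 0 = 0) -> t = 0.
Proof.
move=> H0; have [_ gNp _] := hgN; apply/eqP; apply: contraT => /(gNp q).
(* By surjectivity t is the image of some w, which may be replaced by its horizontal part; the
   pairing is then the squared length of t. *)
have /submxP[w wE] : (t <= A)%MS by apply: submx_full; exact: fF.
have := H0 (w *m H p); rewrite -!mulmxA (hmxK (gMs p) (@gMp p) (fF p)).
rewrite (hmxA (gMs p) (@gMp p) (fF p)) -wE => /(_ erefl).
by rewrite innerE -mulmxA => ->; rewrite ltxx.
Qed.

End MapGeometry.

Theorem theorem4p1 (R : realType) (m n r : nat)
    (M : manifold R (2 * (m + n + r))) (N : manifold R (n + 2 * r))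
    (gM J : M -> 'M[R]_(2 * (m + n + r))) (gN : N -> 'M[R]_(n + 2 * r))
    (nablaM : M -> 'rV[R]_(2 * (m + n + r)) ->
              (M -> 'rV[R]_(2 * (m + n + r))) -> 'rV[R]_(2 * (m + n + r)))
    (nablaN : N -> 'rV[R]_(n + 2 * r) ->
              (N -> 'rV[R]_(n + 2 * r)) -> 'rV[R]_(n + 2 * r))
    (nablaF : M -> 'rV[R]_(2 * (m + n + r)) ->
              (M -> 'rV[R]_(n + 2 * r)) -> 'rV[R]_(n + 2 * r))
    (F : M -> N) (lam : M -> R)
    (hgM : riemannian_metric gM) (hgN : riemannian_metric gN)
    (hnablaM : levi_civita gM nablaM) (hnablaN : levi_civita gN nablaN)
    (hnablaF : is_pullback_connection F nablaN nablaF)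
    (hJ : kahler gM J nablaM)
    (hF : conformal_semi_invariant gM gN m n r J lam F)
    (hdim : (n + 2 * r)%N <> 2%N) :
  [/\ harmonic gM nablaM nablaF F -> minimal_fibres gM nablaM F ->
        horizontally_homothetic gM lam F,
      harmonic gM nablaM nablaF F -> horizontally_homothetic gM lam F ->
        minimal_fibres gM nablaM F
    & minimal_fibres gM nablaM F -> horizontally_homothetic gM lam F ->
        harmonic gM nablaM nablaF F].
Proof.
have [[sF fF] hc _] := hF; have sub : submersion F by [].
(* Over a target of dimension 0 there are no nonzero horizontal vectors, so all three conditions
   hold outright. *)
have [e0|e_gt0] := posnP (n + 2 * r)%N.
  have t0 (v : 'rV[R]_(n + 2 * r)) : v = 0.
    by apply/rowP => i; have := ltn_ord i; rewrite {2}e0.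
  have h0 p : hproj gM F p = 0.
    rewrite (hprojE hgM sub); apply: row_vector_mx_inj => v; rewrite mulmx0.
    by rewrite ker_hmx //; exact: t0.
  split=> _ _ p; rewrite ?t0 //.
    by rewrite h0 mulmx0.
  apply/(fibre_mean_curvature_eq0 gM nablaM F p).
  by rewrite -(mean_hproj nablaM hgM sub p) -(hprojE hgM sub) h0 mulmx0.
have lam0 p : lam p != 0 by rewrite gt_eqF //; case: hc.
have e2 : 2 - (n + 2 * r)%:R != 0 :> R.
  by rewrite subr_eq0 eq_sym eqr_nat; apply/eqP.
have tauE p w := @tension_identity _ _ _ _ _ _ _ _ _ _ _ _ hgM hgN hnablaM hnablaN hnablaF
  sub hc p e_gt0 w.
split=> h1 h2 p.
- apply/(homotheticP lam hgM sub p) => w /[dup] wH /tauE.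
  rewrite h1 (fibre_mean_curvature_eq0 gM nablaM F p).1 // !mul0mx mxE.
  by move/eqP; rewrite mulr0 subr0 eq_sym !mulf_eq0 (negPf (lam0 p)) (negPf e2) => /eqP.
- apply/(fibre_mean_curvature_eq0 gM nablaM F p); apply: (mean_eq0 hgM sub) => w.
  move=> /[dup] wH /tauE; rewrite h1 !mul0mx mxE.
  rewrite ((homotheticP lam hgM sub p).1 (h2 p) w wH) mulr0 sub0r => /eqP.
  by rewrite eq_sym oppr_eq0 mulf_eq0 expf_eq0 (negPf (lam0 p)) andbF => /eqP.
- apply: (tension_eq0 hgM hgN sub (p := p)) => w /[dup] wH /tauE ->.
  rewrite ((homotheticP lam hgM sub p).1 (h2 p) w wH) mulr0.
  by rewrite (fibre_mean_curvature_eq0 gM nablaM F p).1 // !mul0mx mxE mulr0 subrr.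
Qed.
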